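(* $F_e(3,3;4) \leq 860$. That is, there exists a $K_4$-free simple graph on $860$ vertices such that every $2$-coloring of its edges contains a monochromatic triangle.
   Context: For a simple graph $G$, $G \rightarrow (3,3)$ means that every coloring of the edges of $G$ with two colors yields a triangle ($K_3$) all of whose edges have the same color. The edge Folkman number $F_e(3,3;4)$ is the smallest number of vertices of a graph $G$ that contains no $K_4$ (complete graph on 4 vertices) and satisfies $G \rightarrow (3,3)$. *)

(* Defs.v *)
From mathcomp Require Import all_boot.

Set Implicit Arguments.
Unset Strict Implicit.
Unset Printing Implicit Defensive.

Record sgraph := SGraph {
  svertex :> finType;
  sedge : rel svertex;
  sedge_sym : symmetric sedge;
  sedge_irr : irreflexive sedge }.

Definition clique (G : sgraph) (S : {set G}) : Prop :=
  {in S &, forall x y, x != y -> sedge x y}.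

Definition Kfree (k : nat) (G : sgraph) : Prop :=
  forall S : {set G}, clique S -> #|S| <> k.

(* The edge xy is the unordered pair [set x; y]. A colouring is a function on
   all sets of vertices, but its values are only ever read on edges, so
   quantifying over these is quantifying over the 2-colourings of E(G). *)
Definition mono_triangle (G : sgraph) (c : {set G} -> bool) (S : {set G}) :
  Prop :=
  [/\ clique S, #|S| = 3 &
      exists b : bool, {in S &, forall x y, x != y -> c [set x; y] = b}].

(* G -> (3,3) *)
Definition arrows33 (G : sgraph) : Prop :=
  forall c : {set G} -> bool, exists S : {set G}, mono_triangle c S.

Definition folkman_graph (G : sgraph) : Prop := Kfree 4 G /\ arrows33 G.

(* N = F_e(3,3;4). Stated as a relation, since the minimum exists only once
   some such graph is known to exist. *)
Definition is_Fe334 (N : nat) : Prop :=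
  (exists G : sgraph, #|G| = N /\ folkman_graph G) /\
  (forall G : sgraph, folkman_graph G -> N <= #|G|).

(* Main.v *)
(* Let C be the circulant graph on Z/785 whose connection set S is generated by 53.
   It is K4-free, and each of its edges lies in 21 triangles, 7 for each of the three
   other residue classes modulo 5.  Write a 2-colouring without monochromatic
   triangle as f = +1 or -1 on the edges.  In every triangle the three products of
   two of its edge values sum to -1, so that form f f = 0, where form u u is the sum
   of u(xy) u(xz) over ordered triangles xyz plus 7 times the sum of the u(xy)^2.
   Fourier transform turns this form into real symmetric 78 x 78 blocks; up to
   multiplication by 53 there are only seven of them, and an approximate Cholesky
   factorisation shows that the form is positive definite on the functions whose sum
   over the edges between any two residue classes modulo 5 vanishes.  Let Pf be the
   average of f over the edges between two classes.  By equitability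
   form (f - Pf) (f - Pf) = - form Pf Pf <= 0, whence f = Pf: the colouring is pulled
   back from one of the twelve colourings of K5 without monochromatic triangle.  Six
   further vertices, each joined to nine vertices spanning no triangle, rule these
   out, and isolated vertices bring the order to 860. *)

Require Import Defs.
From Stdlib Require Import Reals ZArith FMapPositive Lra Psatz.

(** * A rational approximation of the 785-th roots of unity *)

Section Trigonometry.
Local Open Scope R_scope.

Lemma PI6_bounds : 523596 / 1000000 < PI / 6 < 523599 / 1000000.
Proof.
assert (HP := PI_4). assert (HP0 := PI2_1).
assert (Hs := sin_PI6).
split.
- destruct (Rlt_or_le (523596 / 1000000) (PI / 6)) as [H|H]; [exact H|exfalso].
  apply (sin_incr_1 (PI/6)) in H; try lra.
  destruct (pre_sin_bound (523596/1000000) 0) as [_ H1]; try lra.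
  revert H1; unfold sin_approx, sin_term; simpl; lra.
- destruct (Rlt_or_le (PI / 6) (523599 / 1000000)) as [H|H]; [exact H|exfalso].
  apply (sin_incr_1 (523599 / 1000000)) in H; try lra.
  destruct (pre_sin_bound (523599/1000000) 1) as [H1 _]; try lra.
  revert H1; unfold sin_approx, sin_term.
  change (fact (2 * 3 + 1)) with (720 * 7)%nat.
  simpl; lra.
Qed.

Definition theta : R := 2 * PI / 785.

Lemma theta_bounds : 12 * (523596 / 1000000) / 785 < theta < 12 * (523599 / 1000000) / 785.
Proof. generalize PI6_bounds; unfold theta; lra. Qed.

(* [(c1, s1)] approximates [2 ^ 30 * (cos theta, sin theta)] from inside the
   circle, so that [rot_approx] below does not amplify errors. *)
Definition c1 : Z := 1073707429.
Definition s1 : Z := 8594179.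

Lemma cos_theta_approx : -2 <= 2 ^ 30 * cos theta - IZR c1 <= 2.
Proof.
assert (H := theta_bounds).
destruct (pre_cos_bound theta 0) as [H1 H2]; try lra.
revert H1 H2; unfold cos_approx, cos_term, c1; simpl; intros.
assert (63 / 1000000 < theta * theta < 65 / 1000000) by nra.
assert (0 <= (theta * theta) * (theta * theta) < 5 / 1000000000) by nra.
assert (144 * (523596 / 1000000)^2 / 785^2 <= theta * theta <= 144 * (523599 / 1000000)^2 / 785^2) by nra.
split; lra.
Qed.

Lemma sin_theta_approx : -25 <= 2 ^ 30 * sin theta - IZR s1 <= 25.
Proof.
assert (H := theta_bounds).
destruct (pre_sin_bound theta 0) as [H1 H2]; try lra.
revert H1 H2; unfold sin_approx, sin_term, s1; simpl; intros.
assert (6406 / 100000000 < theta * theta < 6407 / 100000000) by nra.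
assert (5127 / 10000000000 < (theta * theta) * theta < 5129 / 10000000000) by nra.
assert (0 < (theta * theta) * ((theta * theta) * theta) < 1 / 10000000000) by nra.
split; lra.
Qed.

Lemma norm2_add a b c d x y : 0 <= x -> 0 <= y -> a^2 + b^2 <= x^2 -> c^2 + d^2 <= y^2 ->
  (a + c)^2 + (b + d)^2 <= (x + y)^2.
Proof.
intros Hx Hy H1 H2.
assert (a * c + b * d <= x * y); [|nra].
apply Rsqr_incr_0_var; [|nra].
unfold Rsqr.
assert ((a*c+b*d)^2 <= (a^2+b^2)*(c^2+d^2)) by (generalize (pow2_ge_0 (a*d-b*c)); nra).
assert ((a^2+b^2)*(c^2+d^2) <= x^2 * y^2) by (apply Rmult_le_compat; nra).
nra.
Qed.

Definition rot_approx (p : Z * Z) : Z * Z :=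
  ((c1 * fst p - s1 * snd p) / 2 ^ 30, (s1 * fst p + c1 * snd p) / 2 ^ 30)%Z.

Definition near (p : Z * Z) (t e : R) :=
  (2 ^ 30 * cos t - IZR (fst p))^2 + (2 ^ 30 * sin t - IZR (snd p))^2 <= e ^ 2.

Lemma div_bound (a : Z) : 0 <= IZR a / 2^30 - IZR (a / 2 ^ 30) <= 1.
Proof.
assert (H := Z_div_mod_eq_full a (2^30)).
assert (H' := Z.mod_pos_bound a (2^30) eq_refl).
apply (f_equal IZR) in H.
rewrite plus_IZR, mult_IZR in H.
destruct H' as [H1 H2]. apply IZR_le in H1. apply IZR_lt in H2.
change (IZR (2 ^ 30)) with 1073741824 in *.
replace (2^30) with 1073741824 by ring. lra.
Qed.

Lemma rot_approx_near p t e : 0 <= e -> near p t e -> near (rot_approx p) (t + theta) (e + 28).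
Proof.
intros He H; unfold near.
set (P := 2^30) in *.
assert (HP : P = 1073741824) by (unfold P; ring).
set (x := cos t). set (y := sin t).
assert (Hxy : x^2 + y^2 = 1).
{ generalize (sin2_cos2 t); unfold Rsqr; fold x y; lra. }
unfold near in H; fold x y in H.
set (X := IZR (fst p)) in *. set (Y := IZR (snd p)) in *.
set (C := IZR c1 / P). set (S := IZR s1 / P).
assert (Hc := cos_theta_approx). assert (Hs := sin_theta_approx).
fold P in Hc, Hs.
assert (D1 := div_bound (c1 * fst p - s1 * snd p)).
assert (D2 := div_bound (s1 * fst p + c1 * snd p)).
rewrite minus_IZR, !mult_IZR in D1. rewrite plus_IZR, !mult_IZR in D2.
fold X Y P in D1, D2.
change (IZR (fst (rot_approx p))) with (IZR ((c1 * fst p - s1 * snd p) / 2 ^ 30)).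
change (IZR (snd (rot_approx p))) with (IZR ((s1 * fst p + c1 * snd p) / 2 ^ 30)).
set (u := IZR ((c1 * fst p - s1 * snd p) / 2 ^ 30)) in *.
set (v := IZR ((s1 * fst p + c1 * snd p) / 2 ^ 30)) in *.
rewrite cos_plus, sin_plus; fold x y.
set (c := cos theta) in *. set (s := sin theta) in *.
set (a1 := C * (P * x - X) - S * (P * y - Y)).
set (b1 := S * (P * x - X) + C * (P * y - Y)).
set (a2 := (P * c - IZR c1) * x - (P * s - IZR s1) * y).
set (b2 := (P * s - IZR s1) * x + (P * c - IZR c1) * y).
set (a3 := C * X - S * Y - u). set (b3 := S * X + C * Y - v).
replace (P * (x * c - y * s) - u) with ((a1 + a2) + a3)
  by (unfold a1, a2, a3, C, S; rewrite HP; field).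
replace (P * (y * c + x * s) - v) with ((b1 + b2) + b3)
  by (unfold b1, b2, b3, C, S; rewrite HP; field).
replace (e + 28) with (e + 26 + 2) by ring.
apply norm2_add; [lra|lra| |].
- apply norm2_add; [lra|lra| |].
  + replace (a1^2 + b1^2) with ((C^2+S^2) * ((P * x - X)^2 + (P * y - Y)^2))
      by (unfold a1, b1; ring).
    assert (C^2 + S^2 <= 1) by (unfold C, S, c1, s1; rewrite HP; lra).
    generalize (pow2_ge_0 C) (pow2_ge_0 S) (pow2_ge_0 (P * x - X)) (pow2_ge_0 (P * y - Y)); nra.
  + replace (a2^2 + b2^2) with (((P * c - IZR c1)^2 + (P * s - IZR s1)^2) * (x^2+y^2))
      by (unfold a2, b2; ring).
    rewrite Hxy.
    nra.
- assert (0 <= a3 <= 1).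
  { unfold a3. replace (C * X - S * Y) with ((IZR c1 * X - IZR s1 * Y) / P); [exact D1|].
    unfold C, S; rewrite HP; field. }
  assert (0 <= b3 <= 1).
  { unfold b3. replace (S * X + C * Y) with ((IZR s1 * X + IZR c1 * Y) / P); [exact D2|].
    unfold C, S; rewrite HP; field. }
  nra.
Qed.

End Trigonometry.

From mathcomp Require Import all_boot.
Set Implicit Arguments.
Unset Strict Implicit.
Unset Printing Implicit Defensive.

(** * Integer computations *)

Fixpoint index_from (T : Type) (k : positive) (l : seq T) : PositiveMap.t T :=
  if l is x :: l' then PositiveMap.add k x (index_from (Pos.succ k) l')
  else PositiveMap.empty T.

Definition lookup (T : Type) (d : T) (m : PositiveMap.t T) (z : Z) : T :=
  if PositiveMap.find (Z.to_pos (Z.succ z)) m is Some x then x else d.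

Definition zrange : seq Z := [seq Z.of_nat i | i <- iota 0 785].
Definition powers : seq Z := traject (fun x => Z.modulo (53 * x) 785) 1%Z 156.
Definition conn_seq : seq bool := [seq has (Z.eqb z) powers | z <- zrange].
Definition cos_seq : seq Z := [seq Z.div p.1 64 | p <- traject rot_approx (Z.pow 2 30, 0%Z) 785].
Definition conn_map := index_from 1 conn_seq.
Definition cos_map := index_from 1 cos_seq.
Definition connZ (z : Z) : bool := lookup false conn_map (Z.modulo z 785).
Definition cosZ (z : Z) : Z := lookup 0%Z cos_map (Z.modulo z 785).

Definition scale : Z := Z.pow 2 24.

Definition kerZ (b d : Z) : Z := if connZ d then cosZ (b * 393 * d) else 0%Z.
(* [scale] times the Fourier block at [b] in the basis [53 ^ i], [i < 78], of the
   even functions on the connection set ([393] is one half), shifted by [7 - 1/8];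
   for [b] in [157 Z] a form vanishing on class-free vectors is added. *)
Definition block_entry (b : Z) (i j : nat) : Z :=
  let x := nth 0%Z powers i in let y := nth 0%Z powers j in
  (kerZ b (x - y) + kerZ b (x + y)
   + (if i == j then 7 * scale - Z.div scale 8 else 0)
   + (if Z.eqb (Z.modulo b 157) 0 && (odd i == odd j) then scale else 0))%Z.

Fixpoint dot (l m : seq Z) : Z :=
  match l, m with x :: l', y :: m' => (x * y + dot l' m')%Z | _, _ => 0%Z end.

Fixpoint chol_row (a : seq Z) (rows : seq (seq Z)) (l : seq Z) : seq Z :=
  match a, rows with
  | x :: a', r :: rows' => chol_row a' rows' (rcons l (Z.div (x - dot l r) (last 1%Z r)))
  | x :: _, [::] => rcons l (Z.sqrt (x - dot l l))
  | [::], _ => l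
  end.
Definition cholesky (a : nat -> nat -> Z) (n : nat) : seq (seq Z) :=
  foldl (fun L i => rcons L (chol_row [seq a i j | j <- iota 0 i.+1] L [::])) [::] (iota 0 n).

(* Only this check is proved sound: the factor [L] may come from anywhere. *)
Definition gram_check (a : nat -> nat -> Z) (n : nat) (e : Z) (L : seq (seq Z)) : bool :=
  all (fun i => (size (nth [::] L i) <= n) &&
    all (fun j => Z.leb (Z.abs (a i j - dot (nth [::] L i) (nth [::] L j))) e) (iota 0 i.+1))
    (iota 0 n).

Definition block_check (b : Z) : bool :=
  gram_check (block_entry b) 78 23000 (cholesky (block_entry b) 78).
(* Representatives of the orbits of multiplication by [53] on [Z/785]. *)
Definition reps : seq Z := [:: 0; 1; 3; 5; 7; 21; 157]%Z.

From mathcomp Require Import all_order all_algebra ssrZ zify ring lra Rstruct boolp.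
Import Order.TTheory GRing.Theory Num.Theory.
Local Open Scope ring_scope.
Delimit Scope R_scope with coqR.

(** * Fourier transform of edge functions *)

Section Fourier.
Variables (R : realFieldType) (A : finComNzRingType) (cs sn : A -> R).
Hypothesis csD : forall x y, cs (x + y) = cs x * cs y - sn x * sn y.
Hypothesis csN : forall x, cs (- x) = cs x.
Hypothesis snN : forall x, sn (- x) = - sn x.
Hypothesis sum_cs : forall a, \sum_b cs (b * a) = #|A|%:R *+ (a == 0).

Definition ctrans (u : A -> R) b := \sum_m u m * cs (b * m).
Definition strans (u : A -> R) b := \sum_m u m * sn (b * m).

Lemma trans_mul u v b :
  ctrans u b * ctrans v b + strans u b * strans v b =
  \sum_m \sum_m' u m * v m' * cs (b * (m' - m)).
Proof.
rewrite /ctrans /strans !mulr_suml -big_split; apply: eq_bigr => m _ /=.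
rewrite !mulr_sumr -big_split; apply: eq_bigr => m' _ /=.
by rewrite mulrBr csD csN snN; ring.
Qed.

Lemma parseval u v d :
  \sum_b cs (b * d) * (ctrans u b * ctrans v b + strans u b * strans v b) =
  #|A|%:R / 2 * \sum_m (u m * v (m + d) + u m * v (m - d)).
Proof.
have csM x y : cs x * cs y = (cs (x + y) + cs (x - y)) / 2.
  by rewrite !csD csN snN; field.
pose G m m' := u m * v m' * (#|A|%:R / 2)
               * ((m' == m - d)%:R + (m' == m + d)%:R).
transitivity (\sum_m \sum_m' G m m').
  under eq_bigr => b _ do rewrite trans_mul mulr_sumr.
  rewrite exchange_big; apply: eq_bigr => m _ /=.
  under eq_bigr => b _ do rewrite mulr_sumr.
  rewrite exchange_big; apply: eq_bigr => m' _ /=.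
  have -> : G m m' = u m * v m' / 2 * (\sum_b cs (b * (d + (m' - m)))
                        + \sum_b cs (b * (d - (m' - m)))).
    rewrite !sum_cs /G.
    have -> : (d + (m' - m) == 0) = (m' == m - d).
      by rewrite addrCA -[m' == _]subr_eq0 opprB.
    have -> : (d - (m' - m) == 0) = (m' == m + d).
      by rewrite subr_eq0 eq_sym subr_eq addrC.
    rewrite -!(mulr_natr #|A|%:R).
    by move: (#|A|%:R : R) ((m' == m - d)%:R : R) ((m' == m + d)%:R : R) => *; field.
  rewrite mulrDr !mulr_sumr -big_split; apply: eq_bigr => b _ /=.
  by rewrite mulrCA csM -mulrDr -mulrBr; field.
rewrite mulr_sumr; apply: eq_bigr => m _.
under eq_bigr => m' _ do rewrite /G mulrDr.
rewrite big_split /= (bigD1 (m - d)) //= eqxx big1 => [|i /negPf->]; last by rewrite mulr0.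
rewrite (bigD1 (m + d)) //= eqxx big1 => [|i /negPf->]; last by rewrite mulr0.
by rewrite !mulr1 !addr0; move: (#|A|%:R : R) => *; field.
Qed.

Variables (h : A) (w : A -> R) (F : A -> A -> R).
Hypothesis hh : h + h = 1.
Hypothesis wN : forall x, w (- x) = w x.
Hypothesis Fsym : forall x y, F x y = F y x.

(* An edge function in midpoint coordinates: this makes the Fourier blocks real. *)
Definition mid s m := F (m - h * s) (m + h * s).

Lemma midN s m : mid (- s) m = mid s m.
Proof. by rewrite /mid !mulrN opprK Fsym. Qed.

Lemma mid_edge x s : F x (x + s) = mid s (x + h * s).
Proof. by rewrite /mid addrK -addrA -mulrDl hh mul1r. Qed.

Definition triform := \sum_x \sum_y \sum_z w (y - z) * (F x y * F x z).
Definition block b (v : A -> R) :=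
  \sum_s \sum_t w (s - t) * cs (b * (h * (s - t))) * (v s * v t).
Definition chat b s := ctrans (mid s) b.
Definition shat b s := strans (mid s) b.

Lemma shift_sum (x : A) (f : A -> R) : \sum_y f y = \sum_y f (x + y).
Proof. by rewrite (reindex_inj (addrI x)). Qed.

Lemma triform_mid : triform =
  \sum_s \sum_t w (s - t) * \sum_m mid s m * mid t (m - h * (s - t)).
Proof.
pose H s t x := w (s - t) * (mid s (x + h * s) * mid t (x + h * t)).
have -> : triform = \sum_x \sum_s \sum_t H s t x.
  apply: eq_bigr => x _; rewrite (shift_sum x); apply: eq_bigr => s _.
  rewrite (shift_sum x); apply: eq_bigr => t _.
  by rewrite /H !mid_edge opprD addrACA subrr add0r.
rewrite exchange_big; apply: eq_bigr => s _.
rewrite exchange_big; apply: eq_bigr => t _ /=.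
rewrite mulr_sumr (shift_sum (- (h * s))); apply: eq_bigr => m _.
rewrite /H; congr (_ * (mid s _ * mid t _)); ring.
Qed.

Lemma fourier_triform :
  #|A|%:R * triform = \sum_b (block b (chat b) + block b (shat b)).
Proof.
pose H s t d := w (s - t) * \sum_m mid s m * mid t (m + d).
have symH : \sum_s \sum_t H s t (h * (s - t)) = triform.
  rewrite triform_mid (reindex_inj oppr_inj); apply: eq_bigr => s _.
  rewrite (reindex_inj oppr_inj); apply: eq_bigr => t _.
  rewrite /H -opprD wN; congr (_ * _); apply: eq_bigr => m _.
  by rewrite !midN mulrN.
have -> : \sum_b (block b (chat b) + block b (shat b)) =
  \sum_s \sum_t (#|A|%:R / 2) * (H s t (h * (s - t)) + H s t (- (h * (s - t)))).
  under eq_bigr => b _.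
    rewrite /block -big_split.
    under eq_bigr => s _ do rewrite -big_split.
    over.
  rewrite exchange_big; apply: eq_bigr => s _ /=.
  rewrite exchange_big; apply: eq_bigr => t _ /=.
  rewrite /H -mulrDr -big_split mulrCA -parseval mulr_sumr.
  by apply: eq_bigr => b _; rewrite -mulrDr -mulrA.
under eq_bigr => s _ do rewrite -mulr_sumr big_split.
rewrite -mulr_sumr big_split /= symH -triform_mid.
by move: (#|A|%:R : R) triform => *; field.
Qed.

Lemma fourier_norm :
  #|A|%:R * \sum_x \sum_y F x y ^+ 2 =
  \sum_b (\sum_s chat b s ^+ 2 + \sum_s shat b s ^+ 2).
Proof.
have -> : \sum_x \sum_y F x y ^+ 2 = \sum_s \sum_m mid s m ^+ 2.
  under eq_bigr => x _ do rewrite (shift_sum x).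
  rewrite exchange_big; apply: eq_bigr => s _.
  by rewrite [RHS](shift_sum (h * s)); apply: eq_bigr => x _; rewrite mid_edge addrC.
under [RHS]eq_bigr => b _ do rewrite -big_split.
rewrite [RHS]exchange_big mulr_sumr; apply: eq_bigr => s _ /=.
have cs0 : cs 0 = 1.
  have /eqP := sum_cs 0; under eq_bigr => b _ do rewrite mulr0.
  rewrite eqxx mulr1n sumr_const -[_ *+ _]mulr_natl -subr_eq0 -[X in _ - X]mulr1 -mulrBr.
  rewrite mulf_eq0 subr_eq0 pnatr_eq0 => /orP[|/eqP //].
  by rewrite -leqn0 leqNgt (cardD1 0).
transitivity (\sum_b cs (b * 0) * (ctrans (mid s) b * ctrans (mid s) b
                                  + strans (mid s) b * strans (mid s) b)); last first.
  by apply: eq_bigr => b _; rewrite mulr0 cs0 mul1r !expr2.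
rewrite parseval; under [in RHS]eq_bigr => m _ do rewrite addr0 subr0 -expr2 -mulr2n -[_ *+ 2]mulr_natr.
by rewrite -mulr_suml; move: (#|A|%:R : R) => *; field.
Qed.
End Fourier.

(** * Soundness of the semidefiniteness check *)

Section Gram.
Variables (R : realFieldType) (n : nat) (a : nat -> nat -> R) (l : nat -> nat -> R) (e : R).
Hypothesis aC : forall i j : nat, a i j = a j i.
Hypothesis a_l : forall i j : nat, (j <= i < n)%N -> `|a i j - \sum_(k < n) l i k * l j k| <= e.

Lemma gram_bound (x : 'I_n -> R) :
  - (e * n%:R * \sum_i x i ^+ 2) <= \sum_(i < n) \sum_(j < n) a i j * (x i * x j).
Proof.
have al (i j : 'I_n) : `|a i j - \sum_(k < n) l i k * l j k| <= e.
  have [ji|/ltnW ij] := leqP j i; first by rewrite a_l ?ji /=.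
  by rewrite aC; under eq_bigr => k _ do rewrite mulrC; rewrite a_l ?ij /=.
have gram : 0 <= \sum_(i < n) \sum_(j < n) (\sum_(k < n) l i k * l j k) * (x i * x j).
  have -> : \sum_(i < n) \sum_(j < n) (\sum_(k < n) l i k * l j k) * (x i * x j)
            = \sum_(k < n) (\sum_(i < n) l i k * x i) ^+ 2.
    under [RHS]eq_bigr => k _ do rewrite expr2 mulr_suml.
    rewrite [RHS]exchange_big; apply: eq_bigr => i _.
    under [RHS]eq_bigr => k _ do rewrite mulr_sumr.
    rewrite [RHS]exchange_big; apply: eq_bigr => j _.
    by rewrite mulr_suml; apply: eq_bigr => k _; ring.
  by apply: sumr_ge0 => k _; apply: sqr_ge0.
have -> : e * n%:R * \sum_i x i ^+ 2
          = \sum_(i < n) \sum_(j < n) e * ((x i ^+ 2 + x j ^+ 2) / 2).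
  under [RHS]eq_bigr => i _ do rewrite -mulr_sumr -mulr_suml big_split sumr_const card_ord.
  rewrite -mulr_sumr -mulr_suml big_split sumr_const card_ord /= -sumrMnl.
  set S := \sum_i _.
  have -> : \sum_(i < n) x i ^+ 2 *+ n = S *+ n by rewrite sumrMnl.
  by rewrite -mulr_natr; field.
rewrite -sumrN -subr_ge0 -sumrB.
apply: le_trans gram _; apply: ler_sum => i _.
rewrite -sumrN -sumrB; apply: ler_sum => j _.
have := al i j; set g := \sum_(k < n) _; rewrite ler_norml => /andP[lo hi].
have h1 : 0 <= (e + (a i j - g)) * (x i + x j) ^+ 2 by rewrite mulr_ge0 ?sqr_ge0 //; lra.
have h2 : 0 <= (e - (a i j - g)) * (x i - x j) ^+ 2 by rewrite mulr_ge0 ?sqr_ge0 //; lra.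
by rewrite -subr_ge0; move: (addr_ge0 h1 h2); rewrite !expr2 => h; lra.
Qed.
End Gram.

Lemma IZR_dot (l m : seq Z) n : (size l <= n)%N ->
  IZR (dot l m) = \sum_(k < n) IZR (nth Z0 l k) * IZR (nth Z0 m k).
Proof.
elim: l m n => [|x l IH] [|y m] n /= hl; try by
  rewrite big1 // => k _; rewrite ?nth_nil ?mul0r ?mulr0.
case: n hl => // n hl.
by rewrite big_ord_recl /= plus_IZR mult_IZR (IH m n).
Qed.

Lemma gram_check_sound (A : nat -> nat -> R) (a : nat -> nat -> Z) n (e : Z) (D e' : R) L :
  (forall i j : nat, A i j = A j i) ->
  (forall i j : nat, (i < n)%N -> (j < n)%N -> `|D * A i j - IZR (a i j)| <= e') ->
  gram_check a n e L ->
  forall x : 'I_n -> R, - ((IZR e + e') * n%:R * \sum_i x i ^+ 2)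
     <= D * \sum_(i < n) \sum_(j < n) A i j * (x i * x j).
Proof.
move=> AC Aa /allP ok x.
have -> : D * (\sum_(i < n) \sum_(j < n) A i j * (x i * x j))
          = \sum_(i < n) \sum_(j < n) (D * A i j) * (x i * x j).
  rewrite mulr_sumr; apply: eq_bigr => i _; rewrite mulr_sumr.
  by apply: eq_bigr => j _; rewrite mulrA.
apply: (@gram_bound _ n (fun i j => D * A i j) (fun i k => IZR (nth Z0 (nth [::] L i) k))).
  by move=> i j; rewrite AC.
move=> i j /andP[ji i_n].
have /andP[sz /allP /(_ j)] := ok i ltac:(by rewrite mem_iota).
rewrite mem_iota /= add0n ltnS ji => /(_ isT) /Z.leb_le /IZR_le.
rewrite abs_IZR minus_IZR (IZR_dot _ sz) => /RleP.
have := Aa _ _ i_n (leq_ltn_trans ji i_n).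
rewrite RabsE RminusE; set s := \sum_(_ < _) _; rewrite !ler_norml.
by move=> /andP[? ?] /andP[? ?]; apply/andP; split; lra.
Qed.

(** * The circulant graph on [Z/785] *)

(* Kept folded: a literal would put a unary [783] in every ring instance. *)
Definition n783 : nat := 783.
Notation Z785 := 'I_n783.+2.

Definition to_Z (a : Z785) : Z := Z.of_nat a.
Definition of_Z (z : Z) : Z785 := inZp (Z.to_nat (Z.modulo z 785)).

Lemma to_Z_inj : injective to_Z.
Proof. by move=> a b /Nat2Z.inj /val_inj. Qed.

Lemma to_Z_range a : Z.le 0 (to_Z a) /\ Z.lt (to_Z a) 785.
Proof. by have := ltn_ord a; rewrite /to_Z /n783; lia. Qed.

Lemma of_ZK z : to_Z (of_Z z) = Z.modulo z 785.
Proof.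
have h := Z.mod_pos_bound z 785 erefl.
rewrite /to_Z /of_Z /= modn_small; first by rewrite Z2Nat.id; lia.
by rewrite /n783; lia.
Qed.

Lemma to_ZK a : of_Z (to_Z a) = a.
Proof. by apply: to_Z_inj; rewrite of_ZK Z.mod_small //; apply: to_Z_range. Qed.

Lemma of_Z_mod z : of_Z (Z.modulo z 785) = of_Z z.
Proof. by apply: to_Z_inj; rewrite !of_ZK Z.mod_mod. Qed.

Lemma of_nat_modn m : Z.of_nat (m %% n783.+2) = Z.modulo (Z.of_nat m) 785.
Proof.
have -> : Zpos 785 = Z.of_nat n783.+2 by [].
move: n783 => d; apply: (Z.mod_unique_pos _ _ (Z.of_nat (m %/ d.+2))).
  by have := ltn_pmod m (isT : 0 < d.+2)%N; lia.
by rewrite {1}(divn_eq m d.+2); lia.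
Qed.

Lemma of_ZD x y : of_Z (Z.add x y) = of_Z x + of_Z y.
Proof.
apply: to_Z_inj; rewrite of_ZK [RHS]of_nat_modn Nat2Z.inj_add -!/(to_Z _) !of_ZK.
by rewrite -Z.add_mod.
Qed.

Lemma of_ZM x y : of_Z (Z.mul x y) = of_Z x * of_Z y.
Proof.
apply: to_Z_inj; rewrite of_ZK [RHS]of_nat_modn Nat2Z.inj_mul -!/(to_Z _) !of_ZK.
by rewrite -Z.mul_mod.
Qed.

Lemma of_Z0 : of_Z 0 = 0.
Proof. exact: val_inj. Qed.

Lemma of_ZN x : of_Z (Z.opp x) = - of_Z x.
Proof. by apply/(addrI (of_Z x)); rewrite -of_ZD Z.add_opp_diag_r subrr of_Z0. Qed.

Lemma of_ZB x y : of_Z (Z.sub x y) = of_Z x - of_Z y.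
Proof. by rewrite -of_ZN -of_ZD. Qed.

Lemma of_Z1 : of_Z 1 = 1.
Proof. exact: val_inj. Qed.

Lemma cardA : #|{: Z785}| = n783.+2.
Proof. exact: card_ord. Qed.

Definition cs (a : Z785) : R := cos (INR a * theta)%coqR.
Definition sn (a : Z785) : R := sin (INR a * theta)%coqR.

Lemma cos_sin_mod m : cos (INR (m %% n783.+2) * theta) = cos (INR m * theta)
  /\ sin (INR (m %% n783.+2) * theta) = sin (INR m * theta).
Proof.
have -> : (INR m * theta
         = INR (m %% n783.+2) * theta + 2 * INR (m %/ n783.+2) * PI)%coqR.
  rewrite {1}(divn_eq m n783.+2) plus_INR mult_INR [INR n783.+2](_ : _ = 785%coqR); last first.
    by rewrite INR_IZR_INZ.
  by rewrite /theta; Lra.lra.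
by rewrite cos_period sin_period.
Qed.

Lemma csD x y : cs (x + y) = cs x * cs y - sn x * sn y.
Proof. by rewrite /cs (proj1 (cos_sin_mod _)) plus_INR Rmult_plus_distr_r cos_plus. Qed.
Lemma snD x y : sn (x + y) = sn x * cs y + cs x * sn y.
Proof. by rewrite /sn (proj2 (cos_sin_mod _)) plus_INR Rmult_plus_distr_r sin_plus. Qed.
Lemma cs0 : cs 0 = 1.
Proof. by rewrite /cs /= Rmult_0_l cos_0. Qed.
Lemma sn0 : sn 0 = 0.
Proof. by rewrite /sn /= Rmult_0_l sin_0. Qed.
Lemma cs_sn x : cs x ^+ 2 + sn x ^+ 2 = 1.
Proof. by rewrite addrC -!RpowE; have := sin2_cos2 (INR x * theta)%coqR; rewrite !Rsqr_pow2. Qed.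

Lemma csN x : cs (- x) = cs x.
Proof.
have := csD x (- x); have := snD x (- x); rewrite subrr cs0 sn0 => h1 h2.
have h := cs_sn x.
have -> : cs (- x) = cs x * (cs x * cs (- x) - sn x * sn (- x))
    + sn x * (sn x * cs (- x) + cs x * sn (- x)) + cs (- x) * (1 - (cs x ^+ 2 + sn x ^+ 2)) by ring.
by rewrite -h1 -h2 h subrr !mulr0 mulr1 !addr0.
Qed.

Lemma snN x : sn (- x) = - sn x.
Proof.
have := csD x (- x); have := snD x (- x); rewrite subrr cs0 sn0 => h1 h2.
have h := cs_sn x.
have -> : sn (- x) = cs x * (sn x * cs (- x) + cs x * sn (- x))
    - sn x * (cs x * cs (- x) - sn x * sn (- x)) + sn (- x) * (1 - (cs x ^+ 2 + sn x ^+ 2)) by ring.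
by rewrite -h1 -h2 h subrr !mulr0 mulr1 addr0 add0r.
Qed.

Lemma cs_eq1 a : cs a = 1 -> a = 0.
Proof.
move=> h; apply/eqP; apply: contraTT isT => a0; exfalso.
pose t := (INR a * theta / 2)%coqR.
have ha : (0 < INR a < 785)%coqR.
  have h1 := ltn_ord a; have h2 : (0 < a)%N by rewrite lt0n.
  split; first by apply: lt_0_INR; lia.
  rewrite (_ : 785%coqR = INR n783.+2); first by apply: lt_INR; lia.
  by rewrite INR_IZR_INZ.
have th : (0 < theta)%coqR by rewrite /theta; have := PI_RGT_0; Lra.lra.
have s0 : (0 < sin t)%coqR.
  apply: sin_gt_0; rewrite /t; first by Psatz.nra.
  suff : (INR a * theta < 785 * theta)%coqR by rewrite {2}/theta; Lra.lra.
  by apply: Rmult_lt_compat_r => //; tauto.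
have : cos (2 * t)%coqR = (1 - 2 * sin t * sin t)%coqR by rewrite cos_2a_sin.
rewrite (_ : (2 * t = INR a * theta)%coqR); last by rewrite /t; Lra.lra.
have p := Rmult_lt_0_compat _ _ s0 s0.
by rewrite (h : cos (INR a * theta) = 1%coqR) => e; Lra.lra.
Qed.

Lemma sum_cs a : \sum_b cs (b * a) = #|{: Z785}|%:R *+ (a == 0).
Proof.
have [->|a0] := eqVneq a 0.
  by under eq_bigr => b _ do rewrite mulr0 cs0; rewrite sumr_const mulr1n.
pose Z := \sum_b cs (b * a); pose W := \sum_b sn (b * a).
have hZ : Z = Z * cs a - W * sn a.
  rewrite {1}/Z (reindex_inj (addIr 1)) /= /Z /W !mulr_suml -sumrB.
  by apply: eq_bigr => b _; rewrite mulrDl mul1r csD.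
have hW : W = W * cs a + Z * sn a.
  rewrite {1}/W (reindex_inj (addIr 1)) /= /Z /W !mulr_suml -big_split.
  by apply: eq_bigr => b _; rewrite mulrDl mul1r snD [cs (b * a) * _]mulrC [sn a * _]mulrC.
have key : Z * (2 * (1 - cs a)) = 0.
  have h := cs_sn a.
  have -> : Z * (2 * (1 - cs a)) = (Z - (Z * cs a - W * sn a)) * (1 - cs a)
      - sn a * (W - (W * cs a + Z * sn a)) + Z * (1 - (cs a ^+ 2 + sn a ^+ 2)) by ring.
  by rewrite -hZ -hW h !subrr; ring.
move/eqP: key; rewrite !mulf_eq0 subr_eq0 pnatr_eq0 /= mulr0n => /orP[/eqP // | /eqP h].
by move: a0; rewrite (cs_eq1 (esym h)) eqxx.
Qed.

Lemma lookup_index_from (T : Type) (d : T) (l : seq T) (z : Z) : Z.le 0 z ->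
  lookup d (index_from 1 l) z = nth d l (Z.to_nat z).
Proof.
move=> z0; suff gen k p : (Pos.to_nat k <= Pos.to_nat p)%N ->
    (if PositiveMap.find p (index_from k l) is Some x then x else d)
    = nth d l (Pos.to_nat p - Pos.to_nat k).
  rewrite /lookup gen; last by lia.
  by congr nth; lia.
elim: l k p => [|x l IH] k p kp /=; first by rewrite PositiveMap.gempty nth_nil.
have [->|pk] := Pos.eq_dec p k; first by rewrite PositiveMap.gss subnn.
rewrite PositiveMap.gso // IH; last by lia.
by rewrite (_ : (Pos.to_nat p - Pos.to_nat k = (Pos.to_nat p - Pos.to_nat (Pos.succ k)).+1)%N) //; lia.
Qed.

Lemma near_iter k : near (iter k rot_approx (Z.pow 2 30, Z0)) (INR k * theta) (28 * INR k).
Proof.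
elim: k => [|k IH].
  rewrite /near; change (IZR (iter 0 rot_approx (Z.pow 2 30, Z0)).1) with (IZR 1073741824).
  change (IZR (iter 0 rot_approx (Z.pow 2 30, Z0)).2) with (IZR 0).
  by rewrite [INR 0]/= Rmult_0_l cos_0 sin_0; Lra.lra.
rewrite iterS S_INR.
rewrite (_ : ((INR k + 1) * theta = INR k * theta + theta)%coqR); last by Lra.lra.
rewrite (_ : (28 * (INR k + 1) = 28 * INR k + 28)%coqR); last by Lra.lra.
by apply: rot_approx_near => //; have := pos_INR k; Lra.lra.
Qed.

Lemma sq_le_abs (x y e : R) : (0 <= e -> x ^ 2 + y ^ 2 <= e ^ 2 -> - e <= x <= e)%coqR.
Proof. by move=> e0 h; split; Psatz.nra. Qed.

Lemma cosZ_near z : `|IZR scale * cs (of_Z z) - IZR (cosZ z)| <= IZR 350.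
Proof.
have zb := Z.mod_pos_bound z 785 erefl.
pose k := Z.to_nat (Z.modulo z 785).
have kl : (k < 785)%N by rewrite /k; lia.
have -> : cosZ z = Z.div (iter k rot_approx (Z.pow 2 30, Z0)).1 64.
  rewrite /cosZ /cos_map lookup_index_from; last by lia.
  by rewrite /cos_seq (nth_map (Z.pow 2 30, Z0)) ?size_traject // nth_traject.
have -> : cs (of_Z z) = cos (INR k * theta).
  by rewrite /cs; congr (cos (INR _ * _)%coqR); rewrite /of_Z /= modn_small.
have := near_iter k; rewrite /near.
set X := (iter k rot_approx _).1; set Y := (iter k rot_approx _).2.
have k0 := pos_INR k.
have kR : (INR k <= 784)%coqR.
  rewrite (_ : 784%coqR = INR 784); first by apply: le_INR; lia.
  by rewrite INR_IZR_INZ.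
move/sq_le_abs => /(_ ltac:(Lra.lra)) [h1 h2].
have D := Z_div_mod_eq_full X 64; have [m1 m2] := Z.mod_pos_bound X 64 erefl.
move/(f_equal IZR): D; rewrite plus_IZR mult_IZR => D.
move/IZR_le: m1 => m1; move/IZR_lt: m2 => m2.
suff : (Rabs (IZR scale * cos (INR k * theta) - IZR (X / 64)) <= 350)%coqR.
  by move/RleP.
apply: Rabs_le; rewrite [IZR scale](_ : _ = 16777216%coqR) //.
by split; Lra.lra.
Qed.

(* Otherwise unification starts computing in the ring. *)
Local Opaque of_Z.

Definition conn (a : Z785) : bool := connZ (to_Z a).
Definition gen : Z785 := of_Z 53.

Lemma connZ_red z : connZ z = conn (of_Z z).
Proof. by rewrite /conn of_ZK /connZ Z.mod_mod. Qed.

Lemma of_Z_power i : (i < 156)%N -> of_Z (nth Z0 powers i) = gen ^+ i.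
Proof.
move=> i156; rewrite /powers (set_nth_default (Zpos 1)) ?size_traject // nth_traject // => {i156}.
elim: i => [|i IH]; first exact: of_Z1.
by rewrite iterS of_Z_mod of_ZM IH exprS.
Qed.

Lemma conn_has_power a : conn a = has (Z.eqb (to_Z a)) powers.
Proof.
have [z0 z1] := to_Z_range a.
rewrite /conn /connZ Z.mod_small // /conn_map lookup_index_from //.
rewrite /conn_seq (nth_map Z0); last by rewrite size_map size_iota; lia.
by rewrite (nth_map 0%N) ?size_iota ?nth_iota; [congr (has (Z.eqb _) _); lia|lia|lia].
Qed.

Lemma connP a : reflect (exists2 i, (i < 156)%N & a = gen ^+ i) (conn a).
Proof.
rewrite conn_has_power; apply: (iffP (has_nthP Z0)); rewrite size_traject => -[i il].
  by move/Z.eqb_eq => h; exists i => //; rewrite -of_Z_power // -h to_ZK.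
move=> ->; exists i => //; apply/Z.eqb_eq; rewrite -of_Z_power // of_ZK.
have /(all_nthP Z0) /(_ i) : all (fun z => Z.leb 0 z && Z.ltb z 785) powers by vm_compute.
rewrite size_traject il => /(_ isT) /andP[/Z.leb_le ? /Z.ltb_lt ?].
by rewrite Z.mod_small.
Qed.

Lemma gen78 : gen ^+ 78 = -1.
Proof. by rewrite -of_Z_power // -of_Z1 -of_ZN; apply: to_Z_inj; rewrite !of_ZK. Qed.

Lemma gen156 : gen ^+ 156 = 1.
Proof. by rewrite (exprD gen 78 78) gen78 mulrNN mulr1. Qed.

Lemma conn_pow i : conn (gen ^+ i).
Proof.
apply/connP; exists (i %% 156)%N; first by rewrite ltn_pmod.
by rewrite {1}(divn_eq i 156) exprD mulnC exprM gen156 expr1n mul1r.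
Qed.

Lemma conn_mulX i a : conn (gen ^+ i * a) = conn a.
Proof.
apply/idP/idP => /connP[j _]; last by move=> ->; rewrite -exprD conn_pow.
move=> e; suff -> : a = gen ^+ (i * 155 + j) by apply: conn_pow.
by rewrite exprD -e mulrA -exprD (_ : (i * 155 + i = 156 * i)%N) ?exprM ?gen156 ?expr1n ?mul1r //; lia.
Qed.

Lemma connN a : conn (- a) = conn a.
Proof. by rewrite -mulN1r -gen78 conn_mulX. Qed.

Lemma powers_uniq : uniq powers.
Proof. by vm_compute. Qed.

Lemma gen_inj i j : (i < 156)%N -> (j < 156)%N -> gen ^+ i = gen ^+ j -> i = j.
Proof.
move=> i156 j156 e; apply/eqP; rewrite -(nth_uniq Z0 _ _ powers_uniq) ?size_traject //.
have /(all_nthP Z0) rg : all (fun z => Z.leb 0 z && Z.ltb z 785) powers by vm_compute.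
have /andP[/Z.leb_le ? /Z.ltb_lt ?] := rg i ltac:(by rewrite size_traject).
have /andP[/Z.leb_le ? /Z.ltb_lt ?] := rg j ltac:(by rewrite size_traject).
by move: e; rewrite -!of_Z_power // => /(f_equal to_Z); rewrite !of_ZK !Z.mod_small // => ->.
Qed.

Lemma sum_conn (V : nmodType) (f : Z785 -> V) :
  \sum_(s | conn s) f s = \sum_(i < 78) (f (gen ^+ i) + f (- gen ^+ i)).
Proof.
pose r := [seq gen ^+ i | i <- iota 0 156].
have ur : uniq r.
  rewrite map_inj_in_uniq ?iota_uniq // => i j; rewrite !mem_iota /=; exact: gen_inj.
have rS s : (s \in r) = conn s.
  apply/idP/idP => [/mapP[i] | /connP[i il ->]].
    by rewrite mem_iota => il ->; apply: conn_pow.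
  by apply: map_f; rewrite mem_iota.
have -> : \sum_(s | conn s) f s = \sum_(s <- r) f s.
  by move: (r) ur rS => r' ur' rS'; rewrite (big_uniq _ ur'); apply: eq_bigl => s; rewrite rS'.
rewrite /r (iotaD 0 78 78) map_cat big_cat big_split; congr (_ + _).
  by rewrite big_map -[RHS](big_mkord xpredT (fun i => f (gen ^+ i))).
rewrite -[RHS](big_mkord xpredT (fun i => f (- gen ^+ i))) big_map.
rewrite -{1}(addn0 (0 + 78)%N) iotaDl big_map.
by apply: eq_bigr => i _; rewrite exprD gen78 mulN1r.
Qed.

Definition half : Z785 := of_Z 393.
Definition connR (d : Z785) : R := (conn d)%:R.
(* Multiplication by [157 = 785 / 5] encodes the residue of [x] modulo 5. *)
Definition class5 (x : Z785) : Z785 := of_Z 157 * x.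

Lemma half_half : half + half = 1.
Proof. by rewrite -of_ZD -of_Z1; apply: to_Z_inj; rewrite !of_ZK. Qed.

Lemma connRN d : connR (- d) = connR d.
Proof. by rewrite /connR connN. Qed.

Definition ker (b d : Z785) : R := (connR d * cs (b * (half * d)))%R.
Lemma kerN b d : ker b (- d) = ker b d.
Proof. by rewrite /ker connRN !mulrN csN. Qed.

Definition kmat (b : Z785) (i j : nat) : R :=
  (ker b (gen ^+ i - gen ^+ j) + ker b (gen ^+ i + gen ^+ j))%R.

Lemma kmatC b i j : kmat b i j = kmat b j i.
Proof. by rewrite /kmat -[gen ^+ i - _]opprB kerN [gen ^+ i + _]addrC. Qed.

Definition conn_even (v : Z785 -> R) := (forall s, v (- s) = v s) /\ (forall s, ~~ conn s -> v s = 0).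

Lemma sum_support v (f : Z785 -> R) : (forall s, ~~ conn s -> v s = 0) ->
  \sum_s f s * v s = \sum_(s | conn s) f s * v s.
Proof.
move=> v0; rewrite (bigID conn) /= [X in _ + X]big1 ?addr0 // => s sS.
by rewrite v0 ?mulr0.
Qed.

Lemma block_half b v : conn_even v ->
  block cs half connR b v
  = 2 * \sum_(i < 78) \sum_(j < 78) kmat b i j * (v (gen ^+ i) * v (gen ^+ j)).
Proof.
move=> [vN v0]; rewrite /block.
transitivity (\sum_s (\sum_t ker b (s - t) * v t) * v s).
  apply: eq_bigr => s _; rewrite mulr_suml; apply: eq_bigr => t _.
  by rewrite -[RHS]mulrA [v t * _]mulrC.
rewrite sum_support // sum_conn mulr_sumr; apply: eq_bigr => i _.
rewrite !sum_support // !sum_conn vN -mulrDl -big_split mulr_suml mulr_sumr.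
apply: eq_bigr => j _ /=; rewrite vN /kmat !opprK -[- gen ^+ i - _]opprD kerN.
rewrite [- gen ^+ i + _]addrC -[gen ^+ j - gen ^+ i]opprB kerN; ring.
Qed.

Lemma norm_half (v : Z785 -> R) : conn_even v -> \sum_s v s ^+ 2 = 2 * \sum_(i < 78) v (gen ^+ i) ^+ 2.
Proof.
move=> [vN v0]; under eq_bigr => s _ do rewrite expr2.
rewrite (sum_support _ v0) sum_conn mulr_sumr; apply: eq_bigr => i _.
by rewrite vN; ring.
Qed.

Lemma natR n : n%:R = IZR (Z.of_nat n).
Proof. by rewrite -INRE INR_IZR_INZ. Qed.

Lemma kerZ_near b d : `|IZR scale * ker (of_Z b) (of_Z d) - IZR (kerZ b d)| <= IZR 350.
Proof.
rewrite /kerZ /ker /connR -connZ_red; case: (connZ d); last first.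
  by rewrite mul0r mulr0 subrr normr0; apply/RleP/IZR_le.
by rewrite mul1r /half -!of_ZM Z.mul_assoc; apply: cosZ_near.
Qed.

Definition in157 (b : Z) : bool := Z.eqb (Z.modulo b 157) Z0.
Definition shifted_kmat (b : Z) (i j : nat) : R :=
  (kmat (of_Z b) i j + (i == j)%:R * (7 - 8^-1) + (in157 b && (odd i == odd j))%:R)%R.

Lemma block_entry_near b i j : (i < 156)%N -> (j < 156)%N ->
  `|IZR scale * shifted_kmat b i j - IZR (block_entry b i j)| <= IZR 700.
Proof.
move=> i156 j156.
rewrite /block_entry !plus_IZR /shifted_kmat /kmat -!of_Z_power // -of_ZB -of_ZD.
set x := nth _ _ i; set y := nth _ _ j.
have := kerZ_near b (x - y); have := kerZ_near b (x + y).
have -> : IZR (if i == j then Z.sub (Z.mul 7 scale) (Z.div scale 8) else Z0)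
    = IZR scale * ((i == j)%:R * (7 - 8^-1)).
  case: (i == j); last by rewrite mul0r mulr0.
  rewrite mul1r minus_IZR mult_IZR (_ : IZR (Z.div scale 8) = IZR scale / 8).
    by rewrite RminusE RmultE (natR 7); field.
  rewrite (_ : IZR scale = 8 * IZR (Z.div scale 8)); first by field.
  by rewrite (natR 8) -RmultE -mult_IZR.
have -> : IZR (if Z.eqb (Z.modulo b 157) Z0 && (odd i == odd j) then scale else Z0)
    = IZR scale * (in157 b && (odd i == odd j))%:R.
  by rewrite /in157; case: (_ && _); rewrite ?mulr1 ?mulr0.
have -> : IZR 700 = IZR 350 + IZR 350 by rewrite -RplusE -plus_IZR.
rewrite !RplusE; move: (IZR scale) (IZR 350) (ker _ _) (ker _ _) (IZR _) (IZR _) => D e k1 k2 z1 z2.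
rewrite !ler_norml => /andP[? ?] /andP[? ?]; apply/andP; split; lra.
Qed.

Lemma rep_pos b (x : nat -> R) : block_check b ->
  (in157 b -> forall r : bool, \sum_(i < 78 | odd i == r) x i = 0) ->
  100^-1 * \sum_(i < 78) x i ^+ 2 <=
  \sum_(i < 78) \sum_(j < 78) kmat (of_Z b) i j * (x i * x j) + 7 * \sum_(i < 78) x i ^+ 2.
Proof.
move=> ok x0.
have dmatC i j : shifted_kmat b i j = shifted_kmat b j i.
  by rewrite /shifted_kmat kmatC [i == j]eq_sym [odd i == _]eq_sym.
have near i j : (i < 78)%N -> (j < 78)%N ->
    `|IZR scale * shifted_kmat b i j - IZR (block_entry b i j)| <= IZR 700.
  by move=> i78 j78; apply: block_entry_near; lia.
have := gram_check_sound dmatC near ok (fun i : 'I_78 => x i); clear ok near.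
have -> : \sum_(i < 78) \sum_(j < 78) shifted_kmat b i j * (x i * x j) =
    \sum_(i < 78) \sum_(j < 78) kmat (of_Z b) i j * (x i * x j)
    + (7 - 8^-1) * \sum_(i < 78) x i ^+ 2.
  rewrite mulr_sumr -big_split; apply: eq_bigr => i _ /=.
  transitivity (\sum_(j < 78) (kmat (of_Z b) i j * (x i * x j)
     + ((i == j)%:R * (7 - 8^-1) * (x i * x j)
     + (in157 b && (odd i == odd j))%:R * x j * x i))).
    by apply: eq_bigr => j _; rewrite /shifted_kmat -val_eqE /=; ring.
  rewrite !big_split /=; congr (_ + _).
  rewrite (bigD1 i) //= eqxx big1 => [|j /negPf ji]; last by rewrite eq_sym ji !mul0r.
  rewrite -mulr_suml (_ : \sum_(j < 78) _ = 0); first by rewrite mul0r mul1r !addr0.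
  case: (in157 b) x0 => [/(_ isT (odd i)) x0|_] /=; last by rewrite big1 // => j _; rewrite mul0r.
  rewrite -{}[RHS]x0 [RHS]big_mkcond; apply: eq_bigr => j _.
  by rewrite eq_sym; case: eqP => _; rewrite ?mul1r ?mul0r.
have S0 : 0 <= \sum_(i < 78) x i ^+ 2 by apply: sumr_ge0 => i _; apply: sqr_ge0.
move: (\sum_(i < 78) \sum_(j < 78) _) (\sum_(i < 78) x i ^+ 2) S0 => Q X X0.
have margin : (IZR 23000 + IZR 700) * 78 <= IZR scale * (8^-1 - 100^-1) :> R.
  rewrite !natR -!RinvE -!RminusE -!RplusE -!RmultE; apply/RleP.
  by rewrite [IZR scale](_ : _ = 16777216%coqR) //=; Lra.lra.
have D0 : 0 < IZR scale :> R by apply/RltP/IZR_lt.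
move: (IZR scale) (IZR 23000 + IZR 700) D0 margin => D E D0 margin h.
have := ler_wpM2r X0 margin => {}margin.
rewrite -subr_ge0 -(pmulr_rge0 _ D0).
have -> : D * (Q + 7 * X - 100^-1 * X)
  = D * (Q + (7 - 8^-1) * X) + D * (8^-1 - 100^-1) * X by ring.
lra.
Qed.

Lemma block_checks : all block_check reps.
Proof. by vm_compute. Qed.

(* [262], [673] and [486] are the inverses of [3], [7] and [21] modulo 785. *)
Definition cover_candidates (z : Z) : seq (Z * Z) :=
  [:: (z, Zpos 1); (Z.mul z 262, Zpos 3); (Z.mul z 673, Zpos 7); (Z.mul z 486, Zpos 21); (Zpos 1, Z0)]
  ++ [seq (Z.add (Z.div z 5) (Z.mul 157 (Z.of_nat j)), Zpos 5) | j <- iota 0 5]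
  ++ [seq (u, Zpos 157) | u <- take 4 powers].

Definition covered (z : Z) : bool :=
  has (fun p => connZ p.1 && has (Z.eqb p.2) reps && Z.eqb (Z.modulo (Z.mul p.1 p.2) 785) z)
    (cover_candidates z).

Lemma all_covered : all covered zrange.
Proof. by vm_compute. Qed.

Lemma in157_reps : all (fun r => in157 r ==> Z.eqb (Z.modulo (Z.mul r 5) 785) 0) reps.
Proof. by vm_compute. Qed.

Lemma zrangeP (p : pred Z) : all p zrange -> forall a : Z785, p (to_Z a).
Proof.
move/allP => h a; apply: h; apply/mapP; exists (a : nat) => //.
by rewrite mem_iota /= ltn_ord.
Qed.

Lemma rep_of (b : Z785) : exists i r, r \in reps /\ b = gen ^+ i * of_Z r.
Proof.
have /hasP[[u r] _ /andP[/andP[uS /hasP[x xr /Z.eqb_eq rx]] /Z.eqb_eq e]] := zrangeP all_covered b.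
rewrite /= in uS rx e; subst x.
move: uS; rewrite connZ_red => /connP[i _ ui]; exists i, r; split.
  by [].
by rewrite -ui -of_ZM -of_Z_mod e to_ZK.
Qed.

Lemma gen_unit i : gen ^+ i * gen ^+ (155 * i) = 1.
Proof. by rewrite -exprD -{1}[i]mul1n -mulnDl exprM gen156 expr1n. Qed.

Lemma gen_mul_inj i : injective (fun x : Z785 => gen ^+ i * x).
Proof.
move=> x y /= e; rewrite -[x]mul1r -[y]mul1r -(gen_unit i) ![gen ^+ i * _]mulrC.
by rewrite -!mulrA e.
Qed.

Lemma class5_gen i : class5 (gen ^+ i) = (-1) ^+ i./2 * class5 (gen ^+ odd i).
Proof.
have g2 : class5 (gen ^+ 2) = - class5 1.
  by rewrite expr2 /class5 -of_Z1 -!of_ZM -of_ZN; apply: to_Z_inj; rewrite !of_ZK.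
elim/ltn_ind: i => -[|[|i]] IH; [by rewrite expr0 mul1r | by rewrite expr0 mul1r |].
have -> : class5 (gen ^+ i.+2) = - class5 (gen ^+ i).
  transitivity (gen ^+ i * class5 (gen ^+ 2)); first by rewrite /class5 -(addn2 i) exprD mulrCA.
  by rewrite g2 mulrN /class5 mulr1 mulrC.
rewrite IH; last by rewrite !ltnS leqnSn.
by rewrite /= negbK exprS -mulrA mulN1r.
Qed.

Lemma class5_parity i (r : bool) :
  ((class5 (gen ^+ i) == class5 (gen ^+ r))%:R + (class5 (gen ^+ i) == - class5 (gen ^+ r))%:R)%R = (odd i == r)%:R :> R.
Proof.
have neq (x y : Z) : Z.modulo x 785 <> Z.modulo y 785 -> (of_Z x == of_Z y) = false.
  by move=> h; apply/eqP => /(f_equal to_Z); rewrite !of_ZK.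
have g0 : class5 (gen ^+ 0) = of_Z 157 by rewrite /class5 mulr1.
have g1 : class5 (gen ^+ 1) = of_Z (Z.mul 157 53) by rewrite /class5 of_ZM.
rewrite class5_gen -signr_odd; case: (odd i./2) (odd i) r => -[] [] /=;
  by rewrite ?expr0 ?expr1 ?mul1r ?mulN1r ?opprK ?eqr_opp ?eqxx ?g0 ?g1 -?of_ZN ?neq // ?addr0 ?add0r.
Qed.

Definition class_free (v : Z785 -> R) := forall c, \sum_(s | class5 s == c) v s = 0.

Lemma class_free_parity v (r : bool) : conn_even v -> class_free v ->
  \sum_(i < 78 | odd i == r) v (gen ^+ i) = 0.
Proof.
move=> [vN v0] free.
have E c : \sum_s (class5 s == c)%:R * v s = 0.
  rewrite -[RHS](free c) [RHS]big_mkcond; apply: eq_bigr => s _.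
  by case: eqP; rewrite ?mul1r ?mul0r.
have : \sum_s ((class5 s == class5 (gen ^+ r))%:R + (class5 s == - class5 (gen ^+ r))%:R) * v s = 0.
  by under eq_bigr => s _ do rewrite mulrDl; rewrite big_split /= !E addr0.
rewrite sum_support // sum_conn => h.
suff e : 2 * (\sum_(i < 78 | odd i == r) v (gen ^+ i)) = 0.
  by move/eqP: e; rewrite mulf_eq0 pnatr_eq0 /= => /eqP.
rewrite -[RHS]h mulr_sumr [LHS]big_mkcond; apply: eq_bigr => i _.
have class5N x : class5 (- x) = - class5 x by rewrite /class5 mulrN.
rewrite vN class5N (eqr_opp (class5 (gen ^+ i))) (eqr_oppLR (class5 (gen ^+ i))) [in X in _ + X]addrC class5_parity.
by case: eqP => _ /=; rewrite ?mul1r ?mul0r ?addr0 // mulr_natl mulr2n.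
Qed.

Lemma block_pos b v : conn_even v -> (b * of_Z 5 = 0 -> class_free v) ->
  100^-1 * \sum_s v s ^+ 2 <= block cs half connR b v + 7 * \sum_s v s ^+ 2.
Proof.
move=> [vN v0] free.
have [i [r [rr eb]]] := rep_of b.
pose u := gen ^+ (155 * i); pose v' s := v (u * s).
have eu : gen ^+ i * u = 1 by apply: gen_unit.
have uinj : injective (fun s : Z785 => u * s) by apply: gen_mul_inj.
have ev' : conn_even v'.
  by split=> s; rewrite /v' ?mulrN ?vN // => sS; rewrite v0 // conn_mulX.
have -> : block cs half connR b v = block cs half connR (of_Z r) v'.
  rewrite /block (reindex_inj uinj); apply: eq_bigr => s _.
  rewrite (reindex_inj uinj); apply: eq_bigr => t _ /=.
  rewrite -mulrBr /connR conn_mulX eb; congr (_ * cs _ * _).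
  by rewrite -[RHS]mul1r -eu; ring.
have -> : \sum_s v s ^+ 2 = \sum_s v' s ^+ 2 by rewrite (reindex_inj uinj).
have ok : block_check r by apply: (allP block_checks).
rewrite (block_half _ ev') (norm_half ev').
have {ok} := rep_pos (x := fun i => v' (gen ^+ i)) ok.
set Q := \sum_(i < 78) \sum_(j < 78) _; set X := \sum_(i < 78) _.
suff h : in157 r -> forall p : bool, \sum_(i < 78 | odd i == p) v' (gen ^+ i) = 0.
  by move=> /(_ h) ?; lra.
move=> pr p; apply: class_free_parity => // c.
have /free free' : b * of_Z 5 = 0.
  have /allP /(_ r rr) := in157_reps; rewrite pr => /Z.eqb_eq r5.
  by rewrite eb -mulrA -of_ZM -of_Z_mod r5 of_Z0 mulr0.
rewrite -[RHS](free' (u * c)) [RHS](reindex_inj uinj); apply: eq_bigl => s.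
by rewrite /class5 mulrCA (inj_eq uinj).
Qed.

Lemma class5D x y : class5 (x + y) = class5 x + class5 y. Proof. exact: mulrDr. Qed.
Lemma class5N x : class5 (- x) = - class5 x. Proof. exact: mulrN. Qed.
Lemma class5_half x : class5 (half * x) = half * class5 x. Proof. exact: mulrCA. Qed.

Lemma half_add (x : Z785) : half * x + half * x = x.
Proof. by rewrite -mulrDl half_half mul1r. Qed.

Section Spectral.
Variable F : Z785 -> Z785 -> R.
Hypothesis Fsym : forall x y, F x y = F y x.
Hypothesis F0 : forall x y, ~~ conn (x - y) -> F x y = 0.
Hypothesis Fclass : forall c c', \sum_(x | class5 x == c) \sum_(y | class5 y == c') F x y = 0.

Lemma mid_class e c : \sum_(m | class5 m == e) \sum_(s | class5 s == c) mid half F s m = 0.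
Proof.
rewrite -[RHS](Fclass (e - half * c) (e + half * c)).
rewrite [LHS]big_mkcond [RHS]big_mkcond /=.
transitivity (\sum_m \sum_s if (class5 m == e) && (class5 s == c) then mid half F s m else 0).
  by apply: eq_bigr => m _; case: eqP => _ /=; [exact: big_mkcond | rewrite big1].
transitivity (\sum_x \sum_y
    if (class5 x == e - half * c) && (class5 y == e + half * c) then F x y else 0); last first.
  by apply: eq_bigr => m _; case: eqP => _ /=; [rewrite [RHS]big_mkcond | rewrite big1].
under [RHS]eq_bigr => x _ do rewrite (shift_sum x).
rewrite exchange_big [RHS]exchange_big; apply: eq_bigr => s _ /=.
rewrite [RHS](shift_sum (- (half * s))); apply: eq_bigr => m _.
rewrite (mid_edge F half_half) [- _ + _]addrC subrK.
congr (if _ then _ else _).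
have -> : class5 (m - half * s) = class5 m - half * class5 s by rewrite class5D class5N class5_half.
have -> : class5 (m - half * s + s) = class5 m + half * class5 s.
  by rewrite -{2}(half_add s) addrA subrK class5D class5_half.
apply/andP/andP => [[/eqP-> /eqP->] //|[/eqP e1 /eqP e2]].
have ec : class5 s = c.
  rewrite -(half_add (class5 s)) -(half_add c).
  have -> : half * class5 s + half * class5 s = (class5 m + half * class5 s) - (class5 m - half * class5 s) by ring.
  by rewrite e1 e2; ring.
by move: e1; rewrite ec => /addIr ->; rewrite !eqxx.
Qed.

Lemma trans_class_free (T : Z785 -> R) : (forall m m', class5 m = class5 m' -> T m = T m') ->
  class_free (fun s => \sum_m mid half F s m * T m).
Proof.
move=> Tcl c; rewrite exchange_big (partition_big class5 xpredT) //= big1 // => e _.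
have [m0 /eqP m0e|none] := pickP [pred m | class5 m == e]; last by rewrite big_pred0.
rewrite (eq_bigr (fun m => T m0 * \sum_(s | class5 s == c) mid half F s m)).
  by rewrite -mulr_sumr mid_class mulr0.
move=> m /eqP me; rewrite mulr_sumr; apply: eq_bigr => s _.
by rewrite mulrC (Tcl m m0) // me m0e.
Qed.

Lemma mul_class (b m m' : Z785) : b * of_Z 5 = 0 -> class5 m = class5 m' -> b * m = b * m'.
Proof.
move=> b5 /eqP; rewrite -subr_eq0 -class5N -class5D => /eqP mm.
apply/eqP; rewrite -subr_eq0 -mulrBr; apply/eqP.
have one : 1 = of_Z 3 * of_Z 157 + of_Z 63 * of_Z 5.
  by rewrite -!of_ZM -of_ZD -of_Z1; apply: to_Z_inj; rewrite !of_ZK.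
rewrite -[b * _]mulr1 one.
have -> : b * (m - m') * (of_Z 3 * of_Z 157 + of_Z 63 * of_Z 5)
   = b * of_Z 3 * (of_Z 157 * (m - m')) + b * of_Z 5 * (of_Z 63 * (m - m')) by ring.
by rewrite b5 -[of_Z 157 * _]/(class5 (m - m')) mm mulr0 mul0r addr0.
Qed.

Lemma mid_nonconn s m : ~~ conn s -> mid half F s m = 0.
Proof.
move=> sS; rewrite /mid (Fsym) F0 //; suff -> : m + half * s - (m - half * s) = s by [].
by rewrite -{3}(half_add s); ring.
Qed.

Lemma trans_even (T : Z785 -> R) : conn_even (fun s => \sum_m mid half F s m * T m).
Proof.
split=> s; first by apply: eq_bigr => m _; rewrite midN.
by move=> sS; rewrite big1 // => m _; rewrite mid_nonconn ?mul0r.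
Qed.

Lemma spectral :
  100^-1 * \sum_x \sum_y F x y ^+ 2 <= triform connR F + 7 * \sum_x \sum_y F x y ^+ 2.
Proof.
have n0 : 0 < #|{: Z785}|%:R :> R by rewrite cardA ltr0n.
rewrite -subr_ge0 -(pmulr_rge0 _ n0) -addrA -mulrBl mulrDr mulrCA.
rewrite (fourier_triform csD csN snN sum_cs half_half connRN Fsym).
rewrite (fourier_norm csD csN snN sum_cs F half_half).
rewrite mulr_sumr -big_split /=; apply: sumr_ge0 => b _.
have c_pos : 100^-1 * \sum_s chat cs half F b s ^+ 2 <=
    block cs half connR b (chat cs half F b) + 7 * \sum_s chat cs half F b s ^+ 2.
  apply: block_pos; first exact: trans_even.
  by move=> b5; apply: trans_class_free => m m' mm; rewrite (mul_class b5 mm).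
have s_pos : 100^-1 * \sum_s shat sn half F b s ^+ 2 <=
    block cs half connR b (shat sn half F b) + 7 * \sum_s shat sn half F b s ^+ 2.
  apply: block_pos; first exact: trans_even.
  by move=> b5; apply: trans_class_free => m m' mm; rewrite (mul_class b5 mm).
lra.
Qed.
End Spectral.

(** * Colourings without monochromatic triangles *)

Lemma sum_zrange (V : nmodType) (f : Z785 -> V) : \sum_a f a = \sum_(z <- zrange) f (of_Z z).
Proof.
rewrite big_map -[iota 0 785]/(index_iota 0 n783.+2) big_mkord.
by apply: eq_bigr => a _; rewrite -/(to_Z a) to_ZK.
Qed.

Definition class5Z (z : Z) : Z := Z.modulo (Z.mul 157 z) 785.
Lemma of_Z_class5Z z : of_Z (class5Z z) = class5 (of_Z z).
Proof. by rewrite of_Z_mod of_ZM. Qed.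

(* The third vertices of the triangles on the edge [{0, 1}]. *)
Definition links : seq Z := [seq z <- zrange | connZ z && connZ (Z.sub 1 z)].

Lemma links_classes : perm_eq [seq class5Z z | z <- links]
  (nseq 7 (Zpos 314) ++ nseq 7 (Zpos 471) ++ nseq 7 (Zpos 628)).
Proof. by vm_compute. Qed.

Lemma conn_classes : perm_eq [seq class5Z z | z <- zrange & connZ z]
  (nseq 39 (Zpos 157) ++ nseq 39 (Zpos 314) ++ nseq 39 (Zpos 471) ++ nseq 39 (Zpos 628)).
Proof. by vm_compute. Qed.

Definition classes_sum (phi : Z785 -> R) : R :=
  (phi 0 + (phi (of_Z 157) + (phi (of_Z 314) + (phi (of_Z 471) + phi (of_Z 628)))))%R.

Lemma of_Z_mul_eq x y z : Z.modulo (Z.mul x y) 785 = z -> of_Z x * of_Z y = of_Z z.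
Proof. by move=> <-; rewrite of_Z_mod of_ZM. Qed.

Lemma classes_sum_gen i phi : classes_sum (fun c => phi (gen ^+ i * c)) = classes_sum phi.
Proof.
elim: i phi => [|i IH] phi; first by rewrite /classes_sum expr0 !mul1r.
transitivity (classes_sum (fun c => phi (gen * c))).
  rewrite -(IH (fun c => phi (gen * c))) /classes_sum.
  by rewrite !mulrA -!exprS.
rewrite /classes_sum mulr0.
rewrite (of_Z_mul_eq (z := Zpos 471)) // (of_Z_mul_eq (z := Zpos 157)) //.
rewrite (of_Z_mul_eq (z := Zpos 628)) // (of_Z_mul_eq (z := Zpos 314)) //.
by ring.
Qed.

Lemma sum_conn_class5 phi : \sum_s connR s * phi (class5 s) = 39 * (classes_sum phi - phi 0).
Proof.
rewrite sum_zrange.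
transitivity (\sum_(c <- [seq class5Z z | z <- zrange & connZ z]) phi (of_Z c)).
  rewrite [RHS]big_map [RHS]big_filter [RHS]big_mkcond; apply: eq_bigr => z _.
  by rewrite /connR -connZ_red of_Z_class5Z; case: connZ; rewrite ?mul1r ?mul0r.
rewrite (perm_big _ conn_classes) !big_cat !big_nseq !iter_addr_0 /classes_sum -!(mulr_natl (phi _)) /=.
ring.
Qed.

Lemma sum_links s phi : conn s ->
  \sum_z connR z * connR (s - z) * phi (class5 z) = 7 * (classes_sum phi - phi 0 - phi (class5 s)).
Proof.
move=> /connP[i _ ->]; rewrite (reindex_inj (@gen_mul_inj i)) /=.
transitivity (\sum_z connR z * connR (1 - z) * phi (gen ^+ i * class5 z)).
  apply: eq_bigr => z _; rewrite /connR conn_mulX.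
  rewrite -{1}[gen ^+ i]mulr1 -mulrBr conn_mulX; congr (_ * phi _).
  by rewrite /class5 mulrCA.
rewrite sum_zrange.
transitivity (\sum_(c <- [seq class5Z z | z <- links]) phi (gen ^+ i * of_Z c)).
  rewrite [RHS]big_map [RHS]big_filter [RHS]big_mkcond; apply: eq_bigr => z _.
  rewrite /connR -of_Z1 -of_ZB -!connZ_red of_Z_class5Z.
  by case: connZ; case: connZ; rewrite ?mul1r ?mul0r.
rewrite (perm_big _ links_classes) !big_cat !big_nseq !iter_addr_0 -!(mulr_natl (phi _)) /=.
rewrite -(classes_sum_gen i) /classes_sum mulr0.
have -> : class5 (gen ^+ i) = gen ^+ i * of_Z 157 by rewrite /class5 mulrC.
ring.
Qed.

Definition form (u v : Z785 -> Z785 -> R) : R :=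
  (\sum_x \sum_y \sum_z connR (y - z) * (u x y * v x z) + 7 * \sum_x \sum_y u x y * v x y)%R.

Lemma formC u v : form u v = form v u.
Proof.
rewrite /form; congr (_ + 7 * _); last first.
  by apply: eq_bigr => x _; apply: eq_bigr => y _; rewrite mulrC.
apply: eq_bigr => x _; rewrite exchange_big; apply: eq_bigr => y _; apply: eq_bigr => z _.
by rewrite -connRN opprB mulrC [u x z * _]mulrC mulrC.
Qed.

Lemma formBl u v t : form (fun x y => u x y - v x y) t = form u t - form v t.
Proof.
rewrite /form.
have -> : \sum_x \sum_y (u x y - v x y) * t x y
    = \sum_x \sum_y u x y * t x y - \sum_x \sum_y v x y * t x y.
  rewrite -sumrB; apply: eq_bigr => x _; rewrite -sumrB; apply: eq_bigr => y _; exact: mulrBl.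
have -> : \sum_x \sum_y \sum_z connR (y - z) * ((u x y - v x y) * t x z)
    = \sum_x \sum_y \sum_z connR (y - z) * (u x y * t x z)
      - \sum_x \sum_y \sum_z connR (y - z) * (v x y * t x z).
  rewrite -sumrB; apply: eq_bigr => x _; rewrite -sumrB; apply: eq_bigr => y _.
  by rewrite -sumrB; apply: eq_bigr => z _; rewrite mulrBl mulrBr.
ring.
Qed.

Lemma form_diag u : form u u = triform connR u + 7 * \sum_x \sum_y u x y ^+ 2.
Proof.
by congr (_ + 7 * _); apply: eq_bigr => x _; apply: eq_bigr => y _; rewrite expr2.
Qed.

Lemma class5_eq_nonadj x y : class5 x = class5 y -> conn (x - y) = false.
Proof.
move/eqP; rewrite -subr_eq0 -class5N -class5D => /eqP h; apply/negP => /connP[i _ e].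
have : class5 1 = 0.
  by rewrite -(gen_unit i) mulrC -e /class5 mulrCA -/(class5 _) h mulr0.
by rewrite /class5 mulr1 -of_Z0 => /(f_equal to_Z); rewrite !of_ZK.
Qed.

Section ClassFunction.
Variable a : Z785 -> Z785 -> R.
Hypothesis a0 : forall c, a c c = 0.
Definition lift x y : R := (connR (x - y) * a (class5 x) (class5 y))%R.
Definition rho (c : Z785) : R := classes_sum (fun d => a c (c - d)).

Lemma lift_row x : \sum_y lift x y = 39 * rho (class5 x).
Proof.
rewrite (shift_sum x) (reindex_inj oppr_inj) /=.
transitivity (\sum_s connR s * a (class5 x) (class5 x - class5 s)).
  by apply: eq_bigr => s _; rewrite /lift opprD addrA subrr add0r opprK class5D class5N.
by rewrite (sum_conn_class5 (fun d => a (class5 x) (class5 x - d))) subr0 a0 subr0.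
Qed.

Lemma lift_link x y : conn (x - y) ->
  \sum_z connR (y - z) * lift x z + 7 * lift x y = 7 * rho (class5 x).
Proof.
move=> xy; rewrite (shift_sum x) (reindex_inj oppr_inj) /=.
transitivity (\sum_z connR z * connR (x - y - z) * a (class5 x) (class5 x - class5 z) + 7 * lift x y).
  congr (_ + _); apply: eq_bigr => z _; rewrite /lift -class5N -class5D.
  have -> : x - (x - z) = z by ring.
  have -> : y - (x - z) = - (x - y - z) by ring.
  by rewrite connRN mulrCA mulrA.
rewrite (sum_links (fun d => a (class5 x) (class5 x - d)) xy) /lift /connR xy subr0 a0 class5D class5N.
have -> : class5 x - (class5 x - class5 y) = class5 y by ring.
by rewrite /rho /=; ring.
Qed.

Lemma form_lift u : (forall x y, ~~ conn (x - y) -> u x y = 0) ->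
  form u lift = 7 * \sum_x rho (class5 x) * \sum_y u x y.
Proof.
move=> u0; rewrite /form 2!mulr_sumr -big_split; apply: eq_bigr => x _ /=.
rewrite !mulr_sumr -big_split; apply: eq_bigr => y _ /=.
have [xy|xy] := boolP (conn (x - y)); last first.
  by rewrite u0 // !mul0r !mulr0 big1 ?addr0 // => z _; rewrite mul0r mulr0.
transitivity (u x y * (\sum_z connR (y - z) * lift x z + 7 * lift x y)).
  by rewrite mulrDr mulr_sumr mulrCA; congr (_ + _); apply: eq_bigr => z _; rewrite mulrCA.
by rewrite lift_link //; ring.
Qed.

Lemma form_lift_ge0 : 0 <= form lift lift.
Proof.
rewrite form_lift; last by move=> x y xy; rewrite /lift /connR (negPf xy) mul0r.
apply: mulr_ge0 => //; apply: sumr_ge0 => x _; rewrite lift_row.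
by rewrite mulrCA mulr_ge0 // -expr2 sqr_ge0.
Qed.

Lemma form_lift_free u : (forall x y, ~~ conn (x - y) -> u x y = 0) ->
  (forall c c', \sum_(x | class5 x == c) \sum_(y | class5 y == c') u x y = 0) ->
  form u lift = 0.
Proof.
move=> u0 uc; rewrite form_lift // (partition_big class5 xpredT) //= big1 ?mulr0 // => c _.
rewrite (eq_bigr (fun x => rho c * \sum_y u x y)) => [|x /eqP-> //].
rewrite -mulr_sumr (eq_bigr (fun x => \sum_c' \sum_(y | class5 y == c') u x y)); last first.
  by move=> x _; rewrite (partition_big class5 xpredT).
by rewrite exchange_big big1 ?mulr0 // => c' _; apply: uc.
Qed.
End ClassFunction.

Section Coloring.
Variable f : Z785 -> Z785 -> R.
Hypothesis fC : forall x y, f x y = f y x.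
Hypothesis f0 : forall x y, ~~ conn (x - y) -> f x y = 0.
Hypothesis f1 : forall x y, conn (x - y) -> f x y ^+ 2 = 1.
Hypothesis f_tri : forall x y z, conn (x - y) -> conn (x - z) -> conn (y - z) ->
  f x y * f x z + f y x * f y z + f z x * f z y = -1.

Lemma connRC x y : connR (x - y) = connR (y - x).
Proof. by rewrite -connRN opprB. Qed.

Lemma codegree x y : conn (x - y) -> \sum_z connR (y - z) * connR (x - z) = 21.
Proof.
move=> xy; rewrite (shift_sum x) (reindex_inj oppr_inj) /=.
have := sum_links (fun=> 1) xy; rewrite /classes_sum.
rewrite (_ : 7 * _ = 21); last by ring.
move=> <-; apply: eq_bigr => z _; rewrite mulr1 mulrC; congr (connR _ * _); first by ring.
by rewrite connRC; congr connR; ring.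
Qed.

Lemma form_coloring : form f f = 0.
Proof.
pose q x y z := connR (x - y) * connR (x - z) * connR (y - z) * (f x y * f x z).
have trif : \sum_x \sum_y \sum_z connR (y - z) * (f x y * f x z) = \sum_x \sum_y \sum_z q x y z.
  apply: eq_bigr => x _; apply: eq_bigr => y _; apply: eq_bigr => z _; rewrite /q /connR.
  have [xy|xy] := boolP (conn (x - y)); last by rewrite f0 // !mul0r !mulr0.
  have [xz|xz] := boolP (conn (x - z)); last by rewrite [f x z]f0 // !mulr0.
  by rewrite !mul1r.
have trif2 : \sum_x \sum_y \sum_z q x y z = \sum_x \sum_y \sum_z q y x z.
  by rewrite exchange_big.
have trif3 : \sum_x \sum_y \sum_z q x y z = \sum_x \sum_y \sum_z q z x y.
  rewrite [RHS](eq_bigr (fun x => \sum_z \sum_y q z x y)) => [|x _]; last exact: exchange_big.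
  by rewrite [RHS]exchange_big.
have fw x y : f x y * f x y = connR (x - y).
  rewrite -expr2 /connR; have [xy|xy] := boolP (conn (x - y)); first by rewrite f1.
  by rewrite f0 // expr0n.
have sum3 : \sum_x \sum_y \sum_z (q x y z + q y x z + q z x y)
    = - (21 * \sum_x \sum_y f x y * f x y).
  rewrite mulr_sumr -sumrN; apply: eq_bigr => x _.
  rewrite mulr_sumr -sumrN; apply: eq_bigr => y _.
  transitivity (- (connR (x - y) * \sum_z connR (y - z) * connR (x - z))).
    rewrite mulr_sumr -sumrN; apply: eq_bigr => z _.
    rewrite /q [connR (y - x)]connRC [connR (z - x)]connRC [connR (z - y)]connRC /connR.
    have [xy|xy] := boolP (conn (x - y)); last by rewrite !(mul0r, mulr0) !addr0 oppr0.
    have [xz|xz] := boolP (conn (x - z)); last by rewrite !(mul0r, mulr0) !addr0 oppr0.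
    have [yz|yz] := boolP (conn (y - z)); last by rewrite !(mul0r, mulr0) !addr0 oppr0.
    by rewrite !mul1r f_tri.
  rewrite fw /connR; have [xy|xy] := boolP (conn (x - y)); last by rewrite mul0r mulr0 oppr0.
  by rewrite codegree // mul1r mulr1.
have : 3 * (\sum_x \sum_y \sum_z q x y z) = - (21 * \sum_x \sum_y f x y * f x y).
  rewrite -sum3.
  under [RHS]eq_bigr => x _.
    under eq_bigr => y _ do rewrite !big_split /=.
    rewrite !big_split /=; over.
  rewrite !big_split /= -trif2 -trif3; ring.
by rewrite /form trif; lra.
Qed.

Definition pair_sum (u : Z785 -> Z785 -> R) c c' : R := \sum_(x | class5 x == c) \sum_(y | class5 y == c') u x y.
Definition avg c c' : R := (pair_sum f c c' / pair_sum (fun x y => connR (x - y)) c c')%R.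

Lemma f_nonadj x y : class5 x = class5 y -> f x y = 0.
Proof. by move=> h; rewrite f0 // class5_eq_nonadj. Qed.

Lemma avg0 c : avg c c = 0.
Proof.
rewrite /avg /pair_sum big1 ?mul0r // => x /eqP xc; rewrite big1 // => y /eqP yc.
by rewrite f_nonadj ?xc ?yc.
Qed.

Lemma pair_sumC u c c' : (forall x y, u x y = u y x) -> pair_sum u c c' = pair_sum u c' c.
Proof.
move=> uC; rewrite /pair_sum exchange_big; apply: eq_bigr => x _.
by apply: eq_bigr => y _; apply: uC.
Qed.

Lemma avgC c c' : avg c c' = avg c' c.
Proof.
by rewrite /avg (pair_sumC _ _ fC) (pair_sumC (u := fun x y => connR (x - y))) //; apply: connRC.
Qed.

Lemma pair_sum_avg c c' : pair_sum (fun x y => connR (x - y)) c c' * avg c c' = pair_sum f c c'.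
Proof.
rewrite /avg; set n := pair_sum _ c c'.
have [n0|n0] := eqVneq n 0; last by rewrite mulrC divfK.
rewrite n0 mul0r; symmetry; apply: big1 => x xc; apply: big1 => y yc.
rewrite f0 //; apply/negP => xy.
have w0 x' y' : 0 <= connR (x' - y') by apply: ler0n.
have : connR (x - y) <= n.
  rewrite /n /pair_sum (bigD1 x) //= (bigD1 y) //= -addrA lerDl.
  by apply: addr_ge0; apply: sumr_ge0 => ? _; [apply: w0 | apply: sumr_ge0 => ? _].
by rewrite n0 /connR xy ler10.
Qed.

Lemma class_determined x y : f x y = lift avg x y.
Proof.
pose h x y := f x y - lift avg x y.
have lift0 x' y' : ~~ conn (x' - y') -> lift avg x' y' = 0.
  by move=> xy; rewrite /lift /connR (negPf xy) mul0r.
have hC x' y' : h x' y' = h y' x' by rewrite /h fC /lift connRC avgC.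
have h0 x' y' : ~~ conn (x' - y') -> h x' y' = 0.
  by move=> xy; rewrite /h f0 // lift0 // subr0.
have hfree c c' : \sum_(x | class5 x == c) \sum_(y | class5 y == c') h x y = 0.
  under eq_bigr => x' _ do rewrite sumrB.
  rewrite sumrB; apply/eqP; rewrite subr_eq0; apply/eqP.
  rewrite -[LHS]/(pair_sum f c c') -pair_sum_avg /pair_sum mulr_suml.
  apply: eq_bigr => x' /eqP xc; rewrite mulr_suml; apply: eq_bigr => y' /eqP yc.
  by rewrite /lift xc yc.
have hl : form h (lift avg) = 0 by apply: form_lift_free => //; apply: avg0.
have hh : form h h = - form (lift avg) (lift avg).
  have e1 : form h h = form f h - form (lift avg) h := formBl _ _ _.
  have e2 : form h f = form f f - form (lift avg) f := formBl _ _ _.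
  have e3 : form h (lift avg) = form f (lift avg) - form (lift avg) (lift avg) := formBl _ _ _.
  move: e1 e2 e3; rewrite (formC f h) (formC (lift avg) h) (formC (lift avg) f) hl form_coloring.
  lra.
have l0 : 0 <= form (lift avg) (lift avg) by apply: form_lift_ge0; apply: avg0.
have := spectral hC h0 hfree; rewrite -form_diag hh => le.
have sq0 x' y' : 0 <= h x' y' ^+ 2 by apply: sqr_ge0.
have : h x y ^+ 2 <= 0.
  have : h x y ^+ 2 <= \sum_x \sum_y h x y ^+ 2.
    rewrite (bigD1 x) //= (bigD1 y) //= -addrA lerDl.
    by apply: addr_ge0; apply: sumr_ge0 => ? _ //; apply: sumr_ge0.
  by move: (\sum_x \sum_y h x y ^+ 2) le => s; lra.
move=> le0; have : h x y ^+ 2 == 0 by rewrite eq_le le0 sq0.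
by rewrite sqrf_eq0 subr_eq0 => /eqP.
Qed.
End Coloring.

(** * The graph on 860 vertices *)

Definition shiftZ (i : nat) (s : seq Z) : seq Z := [seq Z.add z (Z.of_nat i) | z <- s].

(* Neighbourhoods of the apex vertices: two 5-cycles sharing a vertex, whose edge
   colours alternate around that vertex starting with red on one cycle and with
   blue on the other, for one of the six pairs of complementary pentagons in K5.
   Either colour of the edge from the apex to the shared vertex then propagates to
   a contradiction. Translation by [i] yields the remaining pairs. *)
Definition bowties : seq (seq Z) :=
  [:: Z0; Zpos 461; Zpos 603; Zpos 264; Zpos 101; Zpos 332; Zpos 588; Zpos 676; Zpos 492]
  :: [seq shiftZ i [:: Z0; Zpos 281; Zpos 592; Zpos 19; Zpos 11; Zpos 88; Zpos 72; Zpos 526; Zpos 133]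
     | i <- iota 0 5].

Definition triangles : seq (seq Z) :=
  [seq shiftZ i [:: Z0; Zpos 1; Zpos 512] | i <- iota 0 5]
  ++ [seq shiftZ i [:: Z0; Zpos 1; Zpos 163] | i <- iota 0 5].

(* The position of a pair of residues modulo 5 in [class_pairs]. *)
Definition edge_index (x y : Z) : nat :=
  let i := Z.to_nat (Z.modulo x 5) in let j := Z.to_nat (Z.modulo y 5) in
  if (i < j)%N then ('C(j, 2) + i)%N else ('C(i, 2) + j)%N.

Definition zedge (x y : Z) : bool :=
  connZ (Z.sub x y) && ~~ Z.eqb (Z.modulo x 5) (Z.modulo y 5).

Fixpoint allb (n : nat) (p : pred (seq bool)) : bool :=
  if n is m.+1 then allb m (fun l => p (true :: l)) && allb m (fun l => p (false :: l))
  else p [::].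

Lemma allbP n p : allb n p -> forall l, size l = n -> p l.
Proof.
elim: n p => [|n IH] p /=; first by move=> p0 [].
by move=> /andP[/IH pt /IH pf] [|[] l] //= [] ?; [apply: pt | apply: pf].
Qed.

Definition edge_data (W : seq Z) : seq (nat * nat * nat) :=
  [seq (p, edge_index (nth Z0 W p.1) (nth Z0 W p.2))
  | p <- [seq (k, l) | k <- iota 0 (size W), l <- iota 0 (size W)]
  & zedge (nth Z0 W p.1) (nth Z0 W p.2)].

Definition mono_in (gam : seq bool) (T : seq Z) : bool :=
  let e := nth false gam (edge_index (nth Z0 T 0) (nth Z0 T 1)) in
  [&& zedge (nth Z0 T 0) (nth Z0 T 1), zedge (nth Z0 T 0) (nth Z0 T 2),
      zedge (nth Z0 T 1) (nth Z0 T 2),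
      nth false gam (edge_index (nth Z0 T 0) (nth Z0 T 2)) == e &
      nth false gam (edge_index (nth Z0 T 1) (nth Z0 T 2)) == e].

Definition apex_blocked (gam : seq bool) (W : seq Z) : bool :=
  let E := edge_data W in
  allb 9 (fun chi => has (fun d : nat * nat * nat =>
    let: (k, l, e) := d in
    (nth false chi k == nth false gam e) && (nth false chi l == nth false gam e)) E).

(* [if] rather than [||], which [vm_compute] would evaluate on both sides. *)
Definition doomed (gam : seq bool) : bool :=
  if has (mono_in gam) triangles then true else has (apex_blocked gam) bowties.

Lemma all_doomed : allb 10 doomed.
Proof. by vm_compute. Qed.

Lemma bowties_triangle_free :
  all (fun W => all (fun x => all (fun y => all (fun z =>
    ~~ [&& connZ (Z.sub x y), connZ (Z.sub x z) & connZ (Z.sub y z)]) W) W) W) bowties.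
Proof. by vm_compute. Qed.

Lemma links_independent : all (fun x => all (fun y => ~~ connZ (Z.sub x y)) links) links.
Proof. by vm_compute. Qed.

Lemma size_bowties : all (fun W => size W == 9) bowties.
Proof. by vm_compute. Qed.

Lemma mem_links (p : Z785) : conn p -> conn (1 - p) -> to_Z p \in links.
Proof.
move=> p1 p2; rewrite mem_filter connZ_red to_ZK p1 connZ_red of_ZB to_ZK of_Z1 p2.
by apply/mapP; exists (p : nat); rewrite ?mem_iota ?ltn_ord.
Qed.

Lemma K4_free_circulant (x y z t : Z785) :
  conn (x - y) -> conn (x - z) -> conn (x - t) -> conn (y - z) -> conn (y - t) -> conn (z - t) -> False.
Proof.
move=> /connP[i _ xy] xz xt yz yt zt; pose u := gen ^+ (155 * i).
have u1 : 1 = u * (x - y) by rewrite xy mulrC gen_unit.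
have inl c : conn (x - c) -> conn (y - c) -> to_Z (u * (x - c)) \in links.
  move=> xc yc; apply: mem_links; first by rewrite conn_mulX.
  rewrite u1 -mulrBr conn_mulX -connN; congr (is_true (conn _)): yc; ring.
have /allP/(_ _ (inl _ xt yt)) := allP links_independent _ (inl _ xz yz).
rewrite connZ_red of_ZB !to_ZK -mulrBr conn_mulX -connN.
have -> : - (x - z - (x - t)) = z - t by ring.
by rewrite zt.
Qed.

(* Apexes beyond the last bowtie are isolated vertices. *)
Definition vert : finType := (Z785 + 'I_75)%type.
Definition apex_nbr (v : 'I_75) (x : Z785) : bool := x \in [seq of_Z z | z <- nth [::] bowties v].
Definition adj (p q : vert) : bool :=
  match p, q with
  | inl x, inl y => conn (x - y)
  | inl x, inr v | inr v, inl x => apex_nbr v x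
  | inr _, inr _ => false
  end.

Lemma adj_sym : symmetric adj.
Proof. by move=> [x|v] [y|v'] //=; rewrite -connN opprB. Qed.

Lemma conn0 : conn 0 = false.
Proof. by rewrite -of_Z0 -connZ_red; vm_compute. Qed.

Lemma adj_irr : irreflexive adj.
Proof. by move=> [x|v] //=; rewrite subrr conn0. Qed.

Definition G860 : sgraph := SGraph adj_sym adj_irr.

Lemma card_G860 : #|G860| = 860.
Proof. by rewrite card_sum !card_ord. Qed.

Lemma apex_triangle_free v x y z : apex_nbr v x -> apex_nbr v y -> apex_nbr v z ->
  conn (x - y) -> conn (x - z) -> conn (y - z) -> False.
Proof.
have [vb|vb] := ltnP v (size bowties); last by rewrite /apex_nbr nth_default.
move=> /mapP[X Xv ->] /mapP[Y Yv ->] /mapP[Z Zv ->].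
rewrite -!of_ZB -!connZ_red => xy xz yz.
have /allP/(_ X Xv)/allP/(_ Y Yv)/allP/(_ Z Zv) := all_nthP [::] bowties_triangle_free v vb.
by rewrite xy xz yz.
Qed.

Lemma K4_free_adj (a b c d : vert) :
  adj a b -> adj a c -> adj a d -> adj b c -> adj b d -> adj c d -> False.
Proof.
case: a b c d => [x|v] [y|v1] [z|v2] [t|v3] //= h1 h2 h3 h4 h5 h6.
- exact: (K4_free_circulant h1 h2 h3 h4 h5 h6).
- exact: (apex_triangle_free h3 h5 h6 h1 h2 h4).
- exact: (apex_triangle_free h2 h4 h6 h1 h3 h5).
- exact: (apex_triangle_free h1 h4 h5 h2 h3 h6).
- exact: (apex_triangle_free h1 h2 h3 h4 h5 h6).
Qed.

Lemma K4_free_G860 : Kfree 4 G860.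
Proof.
move=> S cS; rewrite cardE => s4.
have : uniq (enum S) by apply: enum_uniq.
have mem x : x \in enum S -> x \in S by rewrite mem_enum.
case: (enum S) s4 mem => [|a [|b [|c [|d [|? ?]]]]] //= _ mem.
rewrite !inE !negb_or -!andbA => /and5P[ab ac ad bc /and3P[bd cd _]].
have [aS bS cS' dS] : [/\ a \in S, b \in S, c \in S & d \in S].
  by split; apply: mem; rewrite !inE eqxx ?orbT.
by apply: (@K4_free_adj a b c d); apply: cS.
Qed.

Lemma mono_triangle3 (G : sgraph) (c : {set G} -> bool) (a b d : G) :
  sedge a b -> sedge a d -> sedge b d ->
  c [set a; b] = c [set a; d] -> c [set b; d] = c [set a; b] -> mono_triangle c [set a; b; d].
Proof.
move=> ab ad bd e1 e2.
have ne x y : sedge x y -> x != y by move=> xy; apply: contraTneq xy => ->; rewrite sedge_irr.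
split.
- move=> x y; rewrite !inE -!orbA => /or3P[] /eqP-> /or3P[] /eqP->; rewrite ?eqxx // => _;
    by rewrite // sedge_sym.
- by rewrite setUC cardsU1 cards2 !inE negb_or ![d == _]eq_sym !ne.
- exists (c [set a; b]) => x y; rewrite !inE -!orbA.
  by move=> /or3P[] /eqP-> /or3P[] /eqP->; rewrite ?eqxx // => _; rewrite setUC.
Qed.

Lemma class5_mod5 z : class5 (of_Z z) = class5 (of_Z (Z.modulo z 5)).
Proof.
rewrite /class5 -!of_ZM; apply: to_Z_inj; rewrite !of_ZK {1}(Z_div_mod_eq_full z 5).
rewrite (_ : Z.mul 157 (Z.add (Z.mul 5 (Z.div z 5)) (Z.modulo z 5))
  = Z.add (Z.mul 157 (Z.modulo z 5)) (Z.mul (Z.div z 5) 785)); last by lia.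
by rewrite Z.mod_add.
Qed.

Definition class_pairs : seq (nat * nat) :=
  [:: (0, 1); (0, 2); (1, 2); (0, 3); (1, 3); (2, 3); (0, 4); (1, 4); (2, 4); (3, 4)]%N.

Lemma modulo5 z : exists2 i : nat, (i < 5)%N & Z.modulo z 5 = Z.of_nat i.
Proof.
have h := Z.mod_pos_bound z 5 erefl.
by exists (Z.to_nat (Z.modulo z 5)); [lia | rewrite Z2Nat.id //; case: h].
Qed.

Lemma nth_edge_index (D : Z785 -> Z785 -> bool) x y : (forall a b, D a b = D b a) -> zedge x y ->
  nth false [seq D (class5 (of_Z (Z.of_nat p.1))) (class5 (of_Z (Z.of_nat p.2))) | p <- class_pairs]
    (edge_index x y) = D (class5 (of_Z x)) (class5 (of_Z y)).
Proof.
move=> DC.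
have main i j : (i < j < 5)%N ->
    nth false [seq D (class5 (of_Z (Z.of_nat p.1))) (class5 (of_Z (Z.of_nat p.2))) | p <- class_pairs]
      ('C(j, 2) + i)%N = D (class5 (of_Z (Z.of_nat i))) (class5 (of_Z (Z.of_nat j))).
  case/andP; case: j => [|[|[|[|[|j]]]]]; case: i => [|[|[|[|i]]]] ij j5;
    by [discriminate ij | discriminate j5 | reflexivity].
move=> /andP[_]; case: Z.eqb_spec => // xy _.
rewrite [class5 (of_Z x)]class5_mod5 [class5 (of_Z y)]class5_mod5 /edge_index.
have [i i5 ei] := modulo5 x; have [j j5 ej] := modulo5 y.
rewrite ei ej in xy *; rewrite !Nat2Z.id.
have [lt|ge] := ltnP i j; first by apply: main; rewrite lt.
by rewrite DC; apply: main; rewrite i5 ltn_neqAle ge !andbT; apply/eqP => e; rewrite e in xy.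
Qed.

Lemma arrows33_G860 : arrows33 G860.
Proof.
move=> c; apply: contrapT => nomono.
have nm (a b d : G860) : sedge a b -> sedge a d -> sedge b d ->
    c [set a; b] = c [set a; d] -> c [set b; d] = c [set a; b] -> False.
  by move=> *; apply: nomono; exists [set a; b; d]; apply: mono_triangle3.
pose e (x y : Z785) : bool := c [set (inl x : G860); (inl y : G860)].
have eC x y : e x y = e y x by rewrite /e setUC.
pose f (x y : Z785) : R := (connR (x - y) * (-1) ^+ e x y)%R.
have fC x y : f x y = f y x by rewrite /f eC -connRN opprB.
have f0 x y : ~~ conn (x - y) -> f x y = 0 by move=> xy; rewrite /f /connR (negPf xy) mul0r.
have f1 x y : conn (x - y) -> f x y ^+ 2 = 1.
  by move=> xy; rewrite /f /connR xy mul1r sqrr_sign.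
have f_tri x y z : conn (x - y) -> conn (x - z) -> conn (y - z) ->
    f x y * f x z + f y x * f y z + f z x * f z y = -1.
  move=> xy xz yz; rewrite (fC y x) (fC z x) (fC z y) /f /connR xy xz yz !mul1r.
  have := @nm (inl x) (inl y) (inl z) xy xz yz; rewrite -/(e x y) -/(e x z) -/(e y z).
  by case: (e x y) (e x z) (e y z) => -[] [] h; rewrite ?expr1 ?expr0;
    first [ring | case: (h erefl erefl)].
pose D a b : bool := avg f a b < 0.
have DC a b : D a b = D b a by rewrite /D avgC.
have eD x y : conn (x - y) -> e x y = D (class5 x) (class5 y).
  move=> xy; have := class_determined fC f0 f1 f_tri x y.
  rewrite /f /lift /connR xy !mul1r /D => <-; case: (e x y); rewrite ?expr1 ?expr0.
    by rewrite ltrN10.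
  by rewrite ltr10.
pose gam := [seq D (class5 (of_Z (Z.of_nat p.1))) (class5 (of_Z (Z.of_nat p.2))) | p <- class_pairs].
have gamE x y : zedge x y -> nth false gam (edge_index x y) = e (of_Z x) (of_Z y).
  by move=> xy; rewrite nth_edge_index // eD //; case/andP: xy; rewrite connZ_red of_ZB.
have zedgeS x y : zedge x y -> conn (of_Z x - of_Z y) by case/andP; rewrite connZ_red of_ZB.
have := allbP all_doomed (l := gam) (erefl _); rewrite /doomed.
case: hasP => [[T _]|_].
  case/and5P => xy xz yz; rewrite !gamE // => /eqP e1 /eqP e2 _.
  apply: (@nm (inl (of_Z (nth Z0 T 0))) (inl (of_Z (nth Z0 T 1))) (inl (of_Z (nth Z0 T 2)))).
  - exact: zedgeS.
  - exact: zedgeS.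
  - exact: zedgeS.
  - by rewrite -!/(e _ _) e1.
  - by rewrite -!/(e _ _) e2.
case/hasP => W Wb; have [v vb <-] := nthP [::] Wb.
have v75 : (v < 75)%N by apply: leq_trans vb _.
pose V : G860 := inr (Ordinal v75).
set W' := nth _ _ v.
pose chi := [seq c [set V; (inl (of_Z z) : G860)] | z <- W'].
have W9 : size W' = 9 by apply/eqP/(all_nthP [::] size_bowties).
move=> /allbP /(_ chi) -/(_ _)/hasP[]; first by rewrite size_map.
move=> [[k l] i] /mapP[[k' l'] + [-> -> ->]] /=.
rewrite mem_filter => /andP[/= kl /allpairsP[[k2 l2] [/= k9 l9 [ek el]]]]; subst k2 l2.
move: k9 l9; rewrite !mem_iota /= !add0n => k9 l9.
rewrite !(nth_map Z0) // gamE // => /andP[/eqP e1 /eqP e2].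
apply: (@nm V (inl (of_Z (nth Z0 W' k'))) (inl (of_Z (nth Z0 W' l')))).
- by apply: map_f; apply: mem_nth.
- by apply: map_f; apply: mem_nth.
- exact: zedgeS.
- by rewrite e1 e2.
- by rewrite e1.
Qed.

Lemma folkman_G860 : folkman_graph G860.
Proof. by split; [apply: K4_free_G860 | apply: arrows33_G860]. Qed.

Local Close Scope ring_scope.
Local Open Scope nat_scope.

Theorem theorem2 :
  (exists N : nat, is_Fe334 N /\ N <= 860) /\
  (exists G : sgraph, #|G| = 860 /\ folkman_graph G).
Proof.
pose order n := `[< exists G : sgraph, #|G| = n /\ folkman_graph G >].
have order860 : order 860 by apply/asboolP; exists G860; rewrite card_G860; split=> //; exact: folkman_G860.
split; last by exists G860; rewrite card_G860; split=> //; exact: folkman_G860.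
have ex : exists n, order n by exists 860.
case: (ex_minnP ex) => N /asboolP oN minN.
exists N; split; last exact: minN.
by split=> // G FG; apply: minN; apply/asboolP; exists G.
Qed.
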